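(* Let $S$ be a finite nonempty set of positive integers with $i=\max(S)$. Then both sequences $(\alpha_S(\Pi_n))_{n\ge i+2}$ and $(\beta_S(\Pi_n))_{n\ge i+2}$ stabilize beyond $n=4i$.
   Context: $\Pi_n$ is the lattice of set partitions of $\{1,\dots,n\}$ ordered by refinement, with $\mathrm{rank}(\pi)=n-(\text{number of blocks})$. For $T\subseteq\{1,\dots,n-2\}$, $\alpha_T(\Pi_n)$ is the character of the permutation action of $S_n$ on maximal chains of the rank-selected subposet $\{\pi:\mathrm{rank}(\pi)\in T\}$ ($\alpha_\emptyset$ is trivial), and $\beta_S(\Pi_n)=\sum_{T\subseteq S}(-1)^{|S\setminus T|}\alpha_T(\Pi_n)$. For a partition $\lambda$, $\lambda+(m)=(\lambda_1+m,\lambda_2,\dots)$; for $\chi=\sum c_\lambda\chi^\lambda$, $\chi^{(+m)}=\sum c_\lambda\chi^{\lambda+(m)}$. A sequence $(\chi_n)$ stabilizes beyond $n_0$ if $\chi_n=\chi_{n_0}^{(+(n-n_0))}$ for all $n\ge n_0$. *)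

(* Defs.v *)
From HB Require Import structures.
From mathcomp Require Import all_boot all_order all_algebra all_fingroup all_solvable all_field all_character.
Set Implicit Arguments. Unset Strict Implicit. Unset Printing Implicit Defensive.
Import Order.TTheory GRing.Theory Num.Theory.
Local Open Scope ring_scope.

Definition is_partition (n : nat) (l : seq nat) : bool :=
  [&& sorted geq l, all (fun x => 0 < x)%N l & sumn l == n].

Fixpoint allseqs (k n : nat) : seq (seq nat) :=
  if k is k'.+1 then [::] :: [seq j :: s | j <- iota 1 n, s <- allseqs k' n]
  else [:: [::]].

Definition partitions (n : nat) : seq (seq nat) :=
  undup [seq l <- allseqs n n | is_partition n l].

Definition conj_part (l : seq nat) : seq nat :=
  [seq count (fun p => j < p)%N l | j <- iota 0 (head 0%N l)].

Definition shift_part (m : nat) (l : seq nat) : seq nat :=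
  if l is a :: r then (a + m)%N :: r else (if m is 0 then [::] else [:: m]).

(* index of the block of the composition c containing x, blocks being  *)
(* consecutive intervals of sizes c_1, c_2, ...                        *)
Definition blk (c : seq nat) (x : nat) : nat :=
  count (fun k => sumn (take k c) <= x)%N (iota 1 (size c)).

Definition young_set (n : nat) (c : seq nat) : {set 'S_n} :=
  [set s : 'S_n | [forall x : 'I_n, blk c (s x) == blk c x]].

Lemma young_group_set n c : group_set (young_set n c).
Proof.
apply/group_setP; split.
  by rewrite inE; apply/forallP => x; rewrite perm1.
move=> s t; rewrite !inE => /forallP Hs /forallP Ht.
by apply/forallP => x; rewrite permM (eqP (Ht _)) (eqP (Hs _)).
Qed.

Canonical young_group n c := Group (young_group_set n c).

Definition Sn (n : nat) := [set: 'S_n]%G.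

(* build a class function on S_n from a function (0 if not a class function) *)
Definition mkCF (n : nat) (f : 'S_n -> algC) : 'CF(Sn n) :=
  insubd (0 : 'CF(Sn n)) [ffun s => f s].

Definition sgnCF (n : nat) : 'CF(Sn n) :=
  mkCF (fun s : 'S_n => (-1) ^+ odd_perm s).

(* chi^lambda: the unique irreducible character of S_n that is a common  *)
(* constituent of 1 induced from the Young subgroup S_lambda and of sgn  *)
(* induced from S_lambda' (the character of the Specht module);          *)
(* 0 if lambda is not a partition of n.                                  *)
Definition chiP (n : nat) (l : seq nat) : 'CF(Sn n) :=
  if is_partition n l then
    match [pick i : Iirr (Sn n) |
             ('['Ind[Sn n] (1 : 'CF(young_group n l)), 'chi_i] != 0)
          && ('['Ind[Sn n] ('Res[young_group n (conj_part l)] (sgnCF n)), 'chi_i] != 0)]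
    with Some i => 'chi_i | None => 0 end
  else 0.

Definition shiftCF (n0 n : nat) (chi : 'CF(Sn n0)) : 'CF(Sn n) :=
  \sum_(l <- partitions n0) '[chi, chiP n0 l] *: chiP n (shift_part (n - n0) l).

Arguments shiftCF : clear implicits.
Definition stabilizes_beyond (chi : forall n : nat, 'CF(Sn n)) (n0 : nat) : Prop :=
  forall n : nat, (n0 <= n)%N -> chi n = shiftCF n0 n (chi n0).

Definition is_setpart (n : nat) (P : {set {set 'I_n}}) : bool :=
  partition P [set: 'I_n].

Definition prank (n : nat) (P : {set {set 'I_n}}) : nat := (n - #|P|)%N.

Definition refines (n : nat) (P Q : {set {set 'I_n}}) : bool :=
  [forall B in P, [exists C in Q, B \subset C]].

Definition is_chain (n : nat) (T : seq nat) (C : {set {set {set 'I_n}}}) : bool :=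
  [forall P in C, is_setpart P && (prank P \in T)]
  && [forall P in C, forall Q in C, refines P Q || refines Q P].

Definition maxchains (n : nat) (T : seq nat) : {set {set {set {set 'I_n}}}} :=
  [set C : {set {set {set 'I_n}}} | is_chain T C && [forall C' : {set {set {set 'I_n}}}, (C \proper C') ==> ~~ is_chain T C']].

Definition actP (n : nat) (s : 'S_n) (P : {set {set 'I_n}}) : {set {set 'I_n}} :=
  [set (fun x => s x) @: B | B : {set 'I_n} in P].
Definition actC (n : nat) (s : 'S_n) (C : {set {set {set 'I_n}}}) :=
  [set actP s P | P : {set {set 'I_n}} in C].

Definition alpha (n : nat) (T : seq nat) : 'CF(Sn n) :=
  mkCF (fun s : 'S_n => (#|[set C in maxchains n T | actC s C == C]|)%:R).

(* subsets of the duplicate-free list S are the masks of S.            *)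
Definition beta (n : nat) (S : seq nat) : 'CF(Sn n) :=
  \sum_(m : (size S).-tuple bool)
     (-1) ^+ (size S - count id m) *: alpha n (mask m S).

(* Main.v *)
Require Import Defs.
From HB Require Import structures.
From mathcomp Require Import all_boot all_order all_algebra all_fingroup all_solvable all_field all_character.
From mathcomp Require Import zify.
Set Implicit Arguments. Unset Strict Implicit. Unset Printing Implicit Defensive.
Import Order.TTheory GRing.Theory Num.Theory.
Local Open Scope ring_scope.

(** Frobenius reciprocity turns pairings of permutation characters into orbit
    counts.  A chain of partitions of rank at most [i] moves at most [2i] points,
    so the number of [S_n]-orbits on pairs (chain, word of content [nu[n]]) is
    independent of [n >= 4i] when [|nu| <= 2i]; the same holds for pairs of
    words, i.e. for the Gram matrix of the Young permutation characters
    [M^{nu[n]}].  The matrix of multiplicities of [chi^{nu[n]}] in [M^{mu[n]}] is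
    triangular for dominance with positive diagonal, so it is the Cholesky
    factor of that Gram matrix and does not depend on [n] either.  Hence
    neither do the multiplicities of [chi^{nu[n]}] in [alpha_T].  The remaining
    [chi^l] do not occur in [alpha_T]: if [n - l_1 > 2i] some transposition in
    the column group of [l] fixes a given chain, which kills the pairing with
    the character induced from the sign of the column group. *)

(** The bound 4i arises twice: two supports of size 2i must fit among n points, and nu[n] must be a
    partition whenever |nu| <= 2i. The characters [chiP] have no permutation model, so their
    multiplicities cannot be compared between n and n+1 directly. Young characters have one, which
    is why all comparisons go through them and the result is then pulled back by triangularity.
    Since [chiP] picks some common constituent, it must also be proved that these picks exhaust the
    irreducibles. They exist because a diagram can be filled by its row indices, they are distinct
    because dominance is antisymmetric, and there are enough of them because a class function
    orthogonal to all Young characters vanishes. The claim for [beta] follows by linearity, because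
    every subset of S obeys the same bound i. *)

Lemma mkCFE n (f : 'S_n -> algC) :
  (forall s t, f (s ^ t)%g = f s) -> forall s, mkCF f s = f s.
Proof.
move=> fJ s; rewrite /mkCF.
suff cf : is_class_fun <<Sn n>>%g [ffun s => f s].
  by rewrite /fun_of_cfun -[cfun_val _]/(val _) insubdK ?ffunE.
rewrite genGid; apply: intro_class_fun => [x y _ _|x]; first exact: fJ.
by rewrite inE.
Qed.

(** * Permutation characters and orbit counts *)

Section PermChar.

Variables (n : nat) (T : finType) (to : {action 'S_n &-> T}) (X : {set T}).
Hypothesis aX : [acts Sn n, on X | to].

Definition permchar : 'CF(Sn n) := mkCF (fun s => #|('Fix_(X | to)[s])%g|%:R).

Lemma perm_acts_mem s x : (to x s \in X) = (x \in X).
Proof. exact: (acts_act aX (in_setT s)). Qed.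

Lemma permcharE s : permchar s = #|('Fix_(X | to)[s])%g|%:R.
Proof.
apply: mkCFE => {}s t; congr _%:R.
rewrite -[RHS](card_imset _ (act_inj to t)); congr #|pred_of_set _|; apply/setP => x.
apply/setIP/imsetP => [[xX /afix1P xs]|[y /setIP[yX /afix1P ys] ->]].
  exists (to x t^-1%g); rewrite ?actKV //; apply/setIP; rewrite perm_acts_mem; split=> //.
  apply/afix1P; rewrite -{2}xs -!actMin ?inE //; congr (to x _).
  by rewrite conjgE !mulgA mulgK.
rewrite perm_acts_mem; split=> //.
by apply/afix1P; rewrite -actMin ?inE // conjgE !mulgA mulgV mul1g actMin ?inE // ys.
Qed.

Let act_mx (s : 'S_n) : 'M[algC]_#|X| :=
  \matrix_(i, j) (to (enum_val i) s == enum_val j)%:R.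

Let act_mx_repr : mx_repr (Sn n) act_mx.
Proof.
split=> [|s t _ _]; apply/matrixP => i j; rewrite !mxE.
  by rewrite act1 (inj_eq enum_val_inj).
have siX : to (enum_val i) s \in X by rewrite perm_acts_mem enum_valP.
rewrite (bigD1 (enum_rank_in siX (to (enum_val i) s))) //= !mxE enum_rankK_in //.
rewrite eqxx mul1r actMin ?inE // big1 ?addr0 // => k nk; rewrite !mxE.
case: (to _ s =P enum_val k) => [e|_]; last by rewrite mul0r.
by case/eqP: nk; apply: enum_val_inj; rewrite enum_rankK_in.
Qed.

(** The trace of the permutation matrix [act_mx s] counts fixed points. Being a genuine character
    later excludes cancellation between constituents. *)
Lemma permchar_char : permchar \is a character.
Proof.
suff -> : permchar = cfRepr (MxRepresentation act_mx_repr) by apply: cfRepr_char.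
apply/cfun_inP => s sG; rewrite permcharE cfunE sG mulr1n /mxtrace.
under eq_bigr do rewrite mxE.
rewrite -(big_enum_val (fun x => (to x s == x)%:R)) /= -sum1_card natr_sum.
rewrite [LHS](eq_bigl (fun x => (x \in X) && (to x s == x))) => [|x].
  by rewrite big_mkcondr /=; apply: eq_bigr => x _; case: (_ == _).
by rewrite in_setI; congr andb; apply/afix1P/eqP.
Qed.

Lemma permchar_conj s : (permchar s)^* = permchar s.
Proof. by rewrite permcharE conjC_nat. Qed.

End PermChar.

Section ProdAction.
Variables (n : nat) (T U : finType).
Variables (to : {action 'S_n &-> T}) (uo : {action 'S_n &-> U}).

Definition prod_act_fun (z : T * U) (s : 'S_n) := (to z.1 s, uo z.2 s).

Lemma prod_act1 : prod_act_fun^~ 1%g =1 id.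
Proof. by case=> x y; rewrite /prod_act_fun !act1. Qed.

Lemma prod_actM z : act_morph prod_act_fun z.
Proof. by move=> s t; rewrite /prod_act_fun /= !actMin ?inE. Qed.

Definition prod_act : {action 'S_n &-> (T * U)} := TotalAction prod_act1 prod_actM.

Lemma prod_acts (X : {set T}) (Y : {set U}) :
  [acts Sn n, on X | to] -> [acts Sn n, on Y | uo] ->
  [acts Sn n, on setX X Y | prod_act].
Proof.
move=> aX aY; apply/actsP => s _ [x y].
by rewrite !inE /= !perm_acts_mem.
Qed.

(** A product of fixed-point counts is the fixed-point count on the product set, so the
    Frobenius-Cauchy orbit formula applies. *)
Lemma cfdot_permchar (X : {set T}) (Y : {set U}) :
  [acts Sn n, on X | to] -> [acts Sn n, on Y | uo] ->
  '[permchar to X, permchar uo Y]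
    = #|orbit prod_act (Sn n) @: setX X Y|%:R.
Proof.
move=> aX aY; rewrite cfdotE.
have FC := Frobenius_Cauchy (prod_acts aX aY).
apply: (mulfI (neq0CG (Sn n))); rewrite mulVKf ?neq0CG //.
rewrite mulrC -natrM -FC natr_sum; apply: eq_bigr => s _.
rewrite permchar_conj // !permcharE // -natrM -cardsX; congr _%:R.
congr #|pred_of_set _|; apply/setP => -[x y].
rewrite in_setX !in_setI in_setX !(sameP afix1P eqP) /= /prod_act_fun xpair_eqE /=.
by rewrite andbACA.
Qed.

End ProdAction.

(** * Stability of orbit counts when a point is added *)

(* One step of a family of permutation modules with supports bounded by [N]:
   [inc] embeds the [S_n]-set [X] into the [S_n.+1]-set [X'] as the elements
   whose support avoids the last point. *)
Record stable_step (n : nat) (T T' : finType) (to : {action 'S_n &-> T})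
    (to' : {action 'S_n.+1 &-> T'}) (X : {set T}) (X' : {set T'})
    (inc : T -> T') (supp : T' -> {set 'I_n.+1}) (N : nat) : Prop := StableStep {
  ss_acts : [acts Sn n, on X | to];
  ss_acts' : [acts Sn n.+1, on X' | to'];
  ss_inj : {in X &, injective inc};
  ss_inc : {in X, forall x, inc x \in X'};
  ss_equi : forall x s, x \in X -> inc (to x s) = to' (inc x) (lift_perm ord_max ord_max s);
  ss_suppN : {in X, forall x, ord_max \notin supp (inc x)};
  ss_onto : forall x', x' \in X' -> ord_max \notin supp x' -> exists2 x, x \in X & x' = inc x;
  ss_card : forall x', x' \in X' -> (#|supp x'| <= N)%N;
  ss_supp : forall x' s, x' \in X' -> supp (to' x' s) = s @: supp x';
  ss_fix : forall x' (s : 'S_n.+1), x' \in X' -> {in supp x', forall k, s k = k} -> to' x' s = x'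
}.

Lemma ord_max_liftP n (x : 'I_n.+1) : x != ord_max -> exists y : 'I_n, x = lift ord_max y.
Proof. by rewrite eq_sym => /unlift_some[y -> _]; exists y. Qed.

Lemma lift_permP n (g : 'S_n.+1) : g ord_max = ord_max ->
  exists h : 'S_n, g = lift_perm ord_max ord_max h.
Proof.
(* The default is never reached: [g] fixes [ord_max], so no lifted point is sent there. *)
move=> gm; pose f (x : 'I_n) := odflt x (unlift ord_max (g (lift ord_max x))).
have fE x : lift ord_max (f x) = g (lift ord_max x).
  rewrite /f; case: unliftP => [y <- //|] /= /esym.
  rewrite -[in LHS]gm => /perm_inj/eqP; rewrite (negbTE (neq_lift _ _)) //.
have fI : injective f.
  by move=> x y /(congr1 (lift ord_max)); rewrite !fE => /perm_inj/lift_inj.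
exists (perm fI); apply/permP => x.
have [->|/ord_max_liftP[y ->]] := eqVneq x ord_max; first by rewrite lift_perm_id.
by rewrite lift_perm_lift permE fE.
Qed.

Section ProdStable.
Variables (n : nat) (T T' U U' : finType).
Variables (to : {action 'S_n &-> T}) (to' : {action 'S_n.+1 &-> T'}).
Variables (uo : {action 'S_n &-> U}) (uo' : {action 'S_n.+1 &-> U'}).
Variables (X : {set T}) (X' : {set T'}) (Y : {set U}) (Y' : {set U'}).
Variables (inc : T -> T') (supp : T' -> {set 'I_n.+1}) (N : nat).
Variables (jnc : U -> U') (tupp : U' -> {set 'I_n.+1}) (M : nat).

Lemma prod_stable_step :
  stable_step to to' X X' inc supp N -> stable_step uo uo' Y Y' jnc tupp M ->
  stable_step (prod_act to uo) (prod_act to' uo') (setX X Y) (setX X' Y')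
    (fun z => (inc z.1, jnc z.2)) (fun z => supp z.1 :|: tupp z.2) (N + M).
Proof.
case=> a1 a2 a3 a4 a5 a6 a7 a8 a9 a10; case=> b1 b2 b3 b4 b5 b6 b7 b8 b9 b10.
split.
- exact: prod_acts.
- exact: prod_acts.
- move=> [x y] [x' y'] /setXP[xX yY] /setXP[xX' yY'] /= [e1 e2].
  by rewrite (a3 _ _ xX xX' e1) (b3 _ _ yY yY' e2).
- by move=> [x y] /setXP[xX yY] /=; rewrite in_setX a4 ?b4.
- by move=> [x y] s /setXP[xX yY] /=; rewrite /prod_act_fun /= a5 ?b5.
- by move=> [x y] /setXP[xX yY] /=; rewrite in_setU negb_or a6 ?b6.
- move=> [x y] /setXP[xX yY] /=; rewrite in_setU negb_or => /andP[hx hy].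
  have [x0 x0X ->] := a7 x xX hx; have [y0 y0Y ->] := b7 y yY hy.
  by exists (x0, y0); rewrite // in_setX x0X.
- move=> [x y] /setXP[xX yY] /=; apply: leq_trans (leq_card_setU _ _) _.
  by rewrite leq_add ?a8 ?b8.
- by move=> [x y] s /setXP[xX yY] /=; rewrite a9 ?b9 // imsetU.
- move=> [x y] s /setXP[xX yY] /= h; rewrite /prod_act_fun /= a10 ?b10 //.
    by move=> k hk; apply: h; rewrite in_setU hk orbT.
  by move=> k hk; apply: h; rewrite in_setU hk.
Qed.

End ProdStable.

Section StableOrbits.
Variables (n : nat) (T T' : finType).
Variables (to : {action 'S_n &-> T}) (to' : {action 'S_n.+1 &-> T'}).
Variables (X : {set T}) (X' : {set T'}).
Variables (inc : T -> T') (supp : T' -> {set 'I_n.+1}) (N : nat).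
Hypothesis ss : stable_step to to' X X' inc supp N.
Hypothesis leNn : (N <= n)%N.

Let G := Sn n.
Let G' := Sn n.+1.

(** A permutation [g] relating the two images may move [ord_max], but then [g ord_max] lies outside
    the support of [inc y]. Swapping these two points fixes [inc y] and corrects [g] to a
    permutation coming from [S_n]. *)
Lemma stable_orbit_inc x y : x \in X -> y \in X ->
  inc y \in orbit to' G' (inc x) -> y \in orbit to G x.
Proof.
case: ss => a1 a2 a3 a4 a5 a6 a7 a8 a9 a10 xX yX /orbitP[g _ gxy].
have mx : ord_max \notin supp (inc x) by apply: a6.
have my : ord_max \notin supp (inc y) by apply: a6.
have sy : supp (inc y) = g @: supp (inc x) by rewrite -gxy a9 ?a4.
have gm : g ord_max \notin supp (inc y) by rewrite sy mem_imset //; apply: perm_inj.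
pose t := tperm (g ord_max) ord_max.
have ty : to' (inc y) t = inc y.
  apply: a10 => [|k ky]; first exact: a4.
  by rewrite tpermD //; apply: contraTneq ky => <-.
have [h gth] : exists h, (g * t)%g = lift_perm ord_max ord_max h.
  by apply: lift_permP; rewrite permM tpermL.
apply/orbitP; exists h; first by rewrite inE.
apply: a3 => //; first by rewrite perm_acts_mem.
by rewrite a5 // -gth actMin ?inE // gxy ty.
Qed.

(** A support of size at most [N <= n] misses one of the n+1 points, and a transposition makes the
    last point the missed one. *)
Lemma stable_orbit_rep x' : x' \in X' ->
  exists2 x, x \in X & inc x \in orbit to' G' x'.
Proof.
case: ss => a1 a2 a3 a4 a5 a6 a7 a8 a9 a10 xX.
have [k kN] : exists k, k \notin supp x'.
  apply/existsP; rewrite -negb_forall; apply/negP => /forallP h.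
  have := a8 _ xX; have -> : supp x' = setT by apply/setP => k; rewrite inE h.
  by rewrite cardsT card_ord ltnNge leNn.
have yX : to' x' (tperm k ord_max) \in X' by rewrite perm_acts_mem.
have [|x xX0 ex] := a7 _ yX.
  rewrite a9 // -[X in X \notin _](tpermL k ord_max) mem_imset //; exact: perm_inj.
by exists x => //; rewrite -ex mem_orbit ?inE.
Qed.

Lemma stable_orbits : #|orbit to' G' @: X'| = #|orbit to G @: X|.
Proof.
case: (ss) => a1 a2 a3 a4 a5 a6 a7 a8 a9 a10.
have sameO x y : x \in X -> y \in X ->
    (orbit to G x == orbit to G y) = (orbit to' G' (inc x) == orbit to' G' (inc y)).
  move=> xX yX; apply/eqP/eqP => [/orbit_eqP/orbitP[s _ sxy]|/orbit_eqP h].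
    apply/orbit_eqP/orbitP; exists (lift_perm ord_max ord_max s); rewrite ?inE //.
    by rewrite -a5 // sxy.
  by apply/orbit_eqP; apply: stable_orbit_inc.
(* The induced map on orbits; [FE] shows that it does not depend on the picked representative, and
   [set0] is reached only off the orbits of [X]. *)
pose F (O : {set T}) : {set T'} := if [pick x in X | orbit to G x == O] is Some x
  then orbit to' G' (inc x) else set0.
have FE x : x \in X -> F (orbit to G x) = orbit to' G' (inc x).
  move=> xX; rewrite /F; case: pickP => [y /andP[yX]|/(_ x)]; last by rewrite xX eqxx.
  by rewrite sameO // => /eqP.
rewrite -(@card_in_imset _ _ F (orbit to G @: X)) => [|O1 O2]; last first.
  move=> /imsetP[x xX ->] /imsetP[y yX ->]; rewrite !FE // => /eqP.
  by rewrite -sameO // => /eqP.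
congr #|pred_of_set _|; apply/setP => O; apply/imsetP/imsetP.
  case=> x' xX ->; have [x x0X hx] := stable_orbit_rep xX.
  exists (orbit to G x); first by apply: imset_f.
  by rewrite FE //; apply/esym/orbit_eqP.
by case=> _ /imsetP[x xX ->] ->; rewrite FE //; exists (inc x) => //; apply: a4.
Qed.

End StableOrbits.

Lemma cfdot_permchar_step n (T T' U U' : finType)
  (to : {action 'S_n &-> T}) (to' : {action 'S_n.+1 &-> T'})
  (uo : {action 'S_n &-> U}) (uo' : {action 'S_n.+1 &-> U'}) X X' Y Y'
  inc supp N jnc tupp M :
  stable_step to to' X X' inc supp N -> stable_step uo uo' Y Y' jnc tupp M ->
  (N + M <= n)%N ->
  '[permchar to X, permchar uo Y] = '[permchar to' X', permchar uo' Y'].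
Proof.
move=> sX sY le; have sXY := prod_stable_step sX sY.
rewrite !cfdot_permchar ?(ss_acts sX) ?(ss_acts sY) ?(ss_acts' sX) ?(ss_acts' sY) //.
by rewrite (stable_orbits sXY le).
Qed.

(** * The action on chains of set partitions, and their supports *)

Section ChainAction.
Variable n : nat.
Implicit Types (s t : 'S_n) (P Q : {set {set 'I_n}}) (C D : {set {set {set 'I_n}}}).

Lemma perm_imset1 (B : {set 'I_n}) : (fun x => (1%g : 'S_n) x) @: B = B.
Proof. by rewrite (eq_imset (g := id)) ?imset_id // => x; rewrite perm1. Qed.

Lemma perm_imsetM s t (B : {set 'I_n}) :
  (fun x => (s * t)%g x) @: B = (fun x => t x) @: ((fun x => s x) @: B).
Proof. by rewrite -imset_comp; apply: eq_imset => x; rewrite permM. Qed.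

Lemma actP1 P : actP 1 P = P.
Proof.
by rewrite /actP (eq_imset (g := id)) ?imset_id // => B; rewrite perm_imset1.
Qed.

Lemma actPM s t P : actP (s * t) P = actP t (actP s P).
Proof. by rewrite /actP -imset_comp; apply: eq_imset => B; rewrite perm_imsetM. Qed.

Lemma actC1 : (fun C s => actC s C)^~ 1%g =1 id.
Proof. by move=> C; rewrite /actC (eq_imset (g := id)) ?imset_id // => P; rewrite actP1. Qed.

Lemma actCM C : act_morph (fun C s => actC s C) C.
Proof. by move=> s t; rewrite /actC -imset_comp; apply: eq_imset => P; rewrite actPM. Qed.

Definition chain_act : {action 'S_n &-> {set {set {set 'I_n}}}} := TotalAction actC1 actCM.

Lemma set1_actP s P x : ([set s x] \in actP s P) = ([set x] \in P).
Proof.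
rewrite /actP -(imset_set1 (fun x => s x) x) mem_imset //.
exact/imset_inj/perm_inj.
Qed.

Lemma actP_setpart s P : is_setpart P -> is_setpart (actP s P).
Proof.
rewrite /is_setpart -(imset_partition P setT (@perm_inj _ s)).
suff -> : (fun x => s x) @: [set: 'I_n] = setT by [].
by apply/setP => x; rewrite !inE -(permKV s x) mem_imset ?inE //; apply: perm_inj.
Qed.

Lemma actP_rank s P : prank (actP s P) = prank P.
Proof. by rewrite /prank /actP card_imset //; apply/imset_inj/perm_inj. Qed.

Lemma actP_refines s P Q : refines P Q -> refines (actP s P) (actP s Q).
Proof.
move=> /forall_inP h; apply/forall_inP => _ /imsetP[B BP ->].
have /exists_inP[D DQ sBD] := h _ BP.
by apply/exists_inP; exists (s @: D); [exact: imset_f | exact: imsetS].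
Qed.

Lemma actC_chain T s C : is_chain T C -> is_chain T (actC s C).
Proof.
move=> /andP[/forall_inP h1 /forall_inP h2]; apply/andP; split; apply/forall_inP.
  move=> _ /imsetP[P PC ->]; have /andP[p1 p2] := h1 _ PC.
  by rewrite actP_setpart // actP_rank.
move=> _ /imsetP[P PC ->]; apply/forall_inP => _ /imsetP[Q QC ->].
have /forall_inP/(_ _ QC)/orP[] := h2 _ PC => /(actP_refines s) -> //.
by rewrite orbT.
Qed.

Lemma chain_actK s C : actC s^-1 (actC s C) = C.
Proof. exact: (actK chain_act s C). Qed.

Lemma actC_maxchains T s C : C \in maxchains n T -> actC s C \in maxchains n T.
Proof.
rewrite !inE => /andP[cC /forallP mC]; rewrite actC_chain //=.
apply/forallP => D; apply/implyP => pD; apply/negP => /(actC_chain s^-1) cD.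
have /implyP/(_ _)/negP := mC (actC s^-1 D); apply => //.
rewrite -(chain_actK s C); rewrite properEneq in pD; case/andP: pD => nD sD.
by rewrite properEneq imsetS // andbT (inj_eq (act_inj chain_act _)).
Qed.

Lemma maxchains_acts T : [acts Sn n, on maxchains n T | chain_act].
Proof.
apply/actsP => s _ C; apply/idP/idP => [|/actC_maxchains]; last exact.
by move/(actC_maxchains s^-1); rewrite /= chain_actK.
Qed.

Lemma alpha_permchar T : alpha n T = permchar chain_act (maxchains n T).
Proof.
rewrite /alpha /permchar; congr insubd; apply/ffunP => s; rewrite !ffunE.
by congr (#|pred_of_set _|%:R); apply/setP => C; rewrite in_setI in_set (sameP afix1P eqP).
Qed.

Definition psupp P : {set 'I_n} := [set x | [set x] \notin P].
Definition csupp C : {set 'I_n} := [set x | [exists P in C, [set x] \notin P]].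

Lemma csupp_act s C : csupp (actC s C) = s @: csupp C.
Proof.
apply/setP => x; rewrite -(permKV s x) mem_imset; last exact: perm_inj.
rewrite !inE; apply/exists_inP/exists_inP.
  by case=> _ /imsetP[P PC ->] h; exists P => //; rewrite set1_actP in h.
by case=> P PC h; exists (actP s P); [exact: imset_f | rewrite set1_actP].
Qed.

Lemma psuppS P C : P \in C -> psupp P \subset csupp C.
Proof. by move=> PC; apply/subsetP => x; rewrite !inE => h; apply/exists_inP; exists P. Qed.

Lemma actP_fix s P : is_setpart P -> {in psupp P, forall x, s x = x} -> actP s P = P.
Proof.
move=> pP h; apply/eqP; rewrite eqEcard card_imset ?leqnn ?andbT; last first.
  exact/imset_inj/perm_inj.
apply/subsetP => _ /imsetP[B BP ->].
have [/cards1P[x Bx]|nB] := boolP (#|B| == 1)%N.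
  (* If the image of a singleton block were not a block, [s x] would lie in the support and be
     fixed, forcing [s x = x]. *)
  rewrite Bx imset_set1; apply/negPn/negP => hs.
  have : s (s x) = s x by apply: h; rewrite inE.
  by move/perm_inj => e; rewrite e -Bx BP in hs.
rewrite (eq_in_imset (g := id)) ?imset_id // => x xB; apply: h.
rewrite inE; apply: contra nB => xP; case/and3P: pP => _ /trivIsetP tP _.
have := tP _ _ BP xP; have [-> _|_ /(_ isT)] := eqVneq B [set x]; first by rewrite cards1.
by move/pred0P/(_ x); rewrite /= xB inE eqxx.
Qed.

Lemma actC_fix T s C : is_chain T C -> {in csupp C, forall x, s x = x} -> actC s C = C.
Proof.
move=> /andP[/forall_inP h _] hs.
rewrite /actC (eq_in_imset (g := id)) ?imset_id // => P PC; apply: actP_fix.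
  by case/andP: (h _ PC).
by move=> x xP; apply: hs; apply: subsetP x xP; apply: psuppS.
Qed.

(** A block of size b >= 2 adds b to the support and b - 1 to the rank, and b <= 2(b - 1);
    singletons add nothing to either. *)
Lemma card_psupp P : is_setpart P -> (#|psupp P| <= 2 * prank P)%N.
Proof.
move=> pP; have cP := card_partition pP; case/and3P: pP => /eqP cov tP nP.
rewrite cardsT card_ord in cP.
have le1 : (#|psupp P| <= \sum_(B in P) 2 * (#|B| - 1))%N.
  rewrite -sum1dep_card big_mkcond /= (eq_bigl (fun x => x \in cover P)); last first.
    by move=> x; rewrite cov inE.
  rewrite big_trivIset //=; apply: leq_sum => B BP.
  have [/cards1P[x Bx]|nB] := boolP (#|B| == 1)%N.
    by rewrite Bx big_set1 cards1 -Bx BP.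
  apply: leq_trans (_ : \sum_(x in B) 1 <= _)%N; first by apply: leq_sum => x _; case: ifP.
  rewrite sum1_card; have : (0 < #|B|)%N.
    by rewrite card_gt0; apply: contraNneq nP => <-.
  by move: nB; rewrite -/(#|B|); move: #|B| => k; lia.
apply: leq_trans le1 _; rewrite -big_distrr /= leq_mul2l /= /prank.
rewrite leq_subRL ?[X in (_ <= X)%N]cP -?sum1_card; last first.
  by apply: leq_sum => B BP; rewrite card_gt0; apply: contraNneq nP => <-.
rewrite eq_leq // -big_split /=; apply: eq_bigr => B BP.
by rewrite add1n subn1 prednK // card_gt0; apply: contraNneq nP => <-.
Qed.

Lemma setpart_set1 P B x : is_setpart P -> [set x] \in P -> B \in P -> x \in B -> B = [set x].
Proof.
case/and3P => _ /trivIsetP tP _ xP BP xB; apply/eqP; apply: contraTT xB => nB.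
by have /disjointFl -> := tP _ _ BP xP nB; rewrite ?inE.
Qed.

(** A singleton block of the coarser partition can only contain a singleton block of the finer
    one. *)
Lemma refines_psupp P Q : is_setpart P -> is_setpart Q -> refines P Q ->
  psupp P \subset psupp Q.
Proof.
move=> /and3P[/eqP cP _ nP] pQ /forall_inP h; apply/subsetP => x; rewrite !inE.
apply: contra => xQ.
have : x \in cover P by rewrite cP.
case/bigcupP => B BP xB.
have /exists_inP[D DQ /subsetP sBD] := h _ BP.
have Dx := setpart_set1 pQ xQ DQ (sBD _ xB); suff <- : B = [set x] by [].
by apply/eqP; rewrite eqEsubset sub1set xB -Dx andbT; apply/subsetP.
Qed.

(** Supports are nested along a chain, so the whole support is that of a single member and the bound
    does not grow with the length of the chain. *)
Lemma card_csupp T i C : all (fun x => x <= i)%N T -> is_chain T C ->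
  (#|csupp C| <= 2 * i)%N.
Proof.
move=> /allP Ti /andP[/forall_inP h1 /forall_inP h2].
have [->|[P0 P0C]] := set_0Vmem C.
  rewrite (_ : csupp _ = set0) ?cards0 //; apply/setP => x; rewrite !inE.
  by apply/exists_inP => -[P]; rewrite inE.
have [P PC maxP] := arg_maxnP (fun P => #|psupp P|) P0C.
have /andP[pP rP] := h1 _ PC.
apply: leq_trans (_ : #|psupp P| <= _)%N; last first.
  by apply: leq_trans (card_psupp pP) _; rewrite leq_mul2l Ti.
apply/subset_leq_card/subsetP => x; rewrite inE => /exists_inP[Q QC xQ].
have /andP[pQ _] := h1 _ QC.
have xsQ : x \in psupp Q by rewrite inE.
have /forall_inP/(_ _ QC)/orP[] := h2 _ PC => r.
  have sPQ := refines_psupp pP pQ r.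
  suff -> : psupp P = psupp Q by [].
  by apply/eqP; rewrite eqEcard sPQ; apply: maxP.
by apply: (subsetP (refines_psupp pQ pP r)).
Qed.

End ChainAction.

(** * Extending chains by a singleton last block *)

Section ChainInc.
Variable n : nat.
Notation lf := (lift (@ord_max n)).
Notation lastB := ([set (ord_max : 'I_n.+1)]).
Implicit Types (B : {set 'I_n}) (P Q : {set {set 'I_n}}) (C D : {set {set {set 'I_n}}}).

Definition liftS B : {set 'I_n.+1} := lf @: B.
(** A singleton block raises n and the number of blocks together, so the rank is kept; the set
    partitions reached are those whose support avoids the last point. *)
Definition incP P : {set {set 'I_n.+1}} := lastB |: (liftS @: P).
Definition incC C : {set {set {set 'I_n.+1}}} := incP @: C.

Lemma liftS_inj : injective liftS.
Proof. exact: (imset_inj (@lift_inj _ _)). Qed.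

Lemma max_liftS B : ord_max \notin liftS B.
Proof. by apply/imsetP => -[x _ /eqP]; rewrite (negbTE (neq_lift _ _)). Qed.

Lemma liftST : lastB :|: liftS setT = setT.
Proof.
apply/setP => x; rewrite !inE.
have [//|/ord_max_liftP[y ->]] := eqVneq x ord_max.
by rewrite /liftS mem_imset ?inE //; apply: lift_inj.
Qed.

Lemma liftSTD : [set: 'I_n.+1] :\: lastB = liftS setT.
Proof.
rewrite -liftST setDUl setDv set0U; apply/setP => x; rewrite !inE.
by have [->|] := eqVneq x ord_max; rewrite // (negbTE (max_liftS _)).
Qed.

Lemma lastN_liftS P : lastB \notin liftS @: P.
Proof. by apply/imsetP => -[B _ e]; have := max_liftS B; rewrite -e inE eqxx. Qed.

Lemma incP_inj : injective incP.
Proof.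
move=> P Q /setP e; apply: (imset_inj liftS_inj); apply/setP => B.
have := e B; rewrite !in_setU1; have [->|//] := eqVneq B lastB.
by rewrite !(negbTE (lastN_liftS _)).
Qed.

Lemma incP_setpart P : is_setpart P -> is_setpart (incP P).
Proof.
move=> pP; rewrite /is_setpart -liftST; apply: partitionU1.
- by rewrite imset_partition //; apply: lift_inj.
- by apply/set0Pn; exists ord_max; rewrite inE.
- by rewrite disjoints1 max_liftS.
Qed.

Lemma incP_onto (P' : {set {set 'I_n.+1}}) : is_setpart P' -> lastB \in P' ->
  exists2 P, is_setpart P & P' = incP P.
Proof.
move=> pP' lP'; have := partitionD1 pP' lP'; rewrite liftSTD => pD.
exists [set B | liftS B \in P' :\ lastB].
  rewrite /is_setpart -(imset_partition _ _ (@lift_inj _ (@ord_max n))).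
  suff -> : [set lf @: (B : {set _}) | B in [set B | liftS B \in P' :\ lastB]] = P' :\ lastB by [].
  apply/setP => B'; apply/imsetP/idP => [[B hB ->]|hB']; first by rewrite inE in hB.
  suff e : B' = liftS (lf @^-1: B') by exists (lf @^-1: B') => //; rewrite inE -e.
  apply/setP => x; have /subsetP sB := partitionS pD hB'.
  apply/idP/imsetP => [xB|[y]]; last by rewrite inE => ? ->.
  by have /imsetP[y _ e] := sB _ xB; exists y => //; rewrite inE -e.
apply/setP => B'; rewrite in_setU1; have [->//|nB] := eqVneq B' lastB.
apply/idP/imsetP => [hB'|[B]]; last by rewrite !inE => /andP[_ h] ->.
have hB'' : B' \in P' :\ lastB by rewrite !inE nB.
suff e : B' = liftS (lf @^-1: B') by exists (lf @^-1: B') => //; rewrite inE -e.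
apply/setP => x; have /subsetP sB := partitionS pD hB''.
apply/idP/imsetP => [xB|[y]]; last by rewrite inE => ? ->.
by have /imsetP[y _ e] := sB _ xB; exists y => //; rewrite inE -e.
Qed.

Lemma incP_rank P : prank (incP P) = prank P.
Proof. by rewrite /prank cardsU1 lastN_liftS card_imset ?add1n ?subSS //; apply: liftS_inj. Qed.

Lemma incP_refines P Q : is_setpart P -> refines (incP P) (incP Q) = refines P Q.
Proof.
move=> pP; apply/forall_inP/forall_inP => h B.
  move=> BP; have : liftS B \in incP P by rewrite !inE imset_f ?orbT.
  move/h/exists_inP => [D']; rewrite in_setU1 => /orP[/eqP->|/imsetP[D DQ ->]] s.
    have : B != set0 by apply: partition_neq0 pP BP.
    case/set0Pn => x xB; have /(subsetP s) : lf x \in liftS B by apply: imset_f.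
    by rewrite inE eq_sym (negbTE (neq_lift _ _)).
  apply/exists_inP; exists D => //; apply/subsetP => x xB.
  have /(subsetP s) : lf x \in liftS B by apply: imset_f.
  by rewrite mem_imset //; apply: lift_inj.
rewrite in_setU1 => /orP[/eqP->|/imsetP[B0 BP ->]].
  by apply/exists_inP; exists lastB; rewrite // in_setU1 eqxx.
have /exists_inP[D DQ sBD] := h _ BP; apply/exists_inP; exists (liftS D).
  by rewrite in_setU1 imset_f ?orbT.
exact: imsetS.
Qed.

Lemma incC_chain T C : is_chain T C -> is_chain T (incC C).
Proof.
move=> /andP[/forall_inP h1 /forall_inP h2]; apply/andP; split; apply/forall_inP.
  move=> _ /imsetP[P PC ->]; have /andP[p1 p2] := h1 _ PC.
  by rewrite incP_setpart // incP_rank.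
move=> _ /imsetP[P PC ->]; apply/forall_inP => _ /imsetP[Q QC ->].
have /andP[p1 _] := h1 _ PC; have /andP[p2 _] := h1 _ QC.
by rewrite !incP_refines //; have /forall_inP/(_ _ QC) := h2 _ PC.
Qed.

Lemma incC_onto T (C' : {set {set {set 'I_n.+1}}}) :
  is_chain T C' -> ord_max \notin csupp C' -> exists2 C, is_chain T C & C' = incC C.
Proof.
move=> /andP[/forall_inP h1 /forall_inP h2] mC.
pose C := [set P | is_setpart P && (incP P \in C')].
have eC : C' = incC C.
  apply/setP => P'; apply/idP/imsetP => [P'C|[P]]; last by rewrite inE => /andP[_ h] ->.
  have /andP[pP' _] := h1 _ P'C.
  have lP' : lastB \in P'.
    by apply: contraR mC => lP'; rewrite inE; apply/exists_inP; exists P'.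
  have [P pP e] := incP_onto pP' lP'; exists P => //.
  by rewrite inE pP -e.
exists C => //; apply/andP; split; apply/forall_inP => P; rewrite inE => /andP[pP PC].
  by have /andP[_] := h1 _ PC; rewrite incP_rank pP.
apply/forall_inP => Q; rewrite inE => /andP[pQ QC].
by have /forall_inP/(_ _ QC) := h2 _ PC; rewrite !incP_refines.
Qed.

Lemma incC_inj : injective incC.
Proof. exact: (imset_inj incP_inj). Qed.

Lemma incC_suppN C : ord_max \notin csupp (incC C).
Proof.
rewrite inE; apply/exists_inP => -[_ /imsetP[P _ ->]].
by rewrite in_setU1 eqxx.
Qed.

Lemma incP_act P (s : 'S_n) : incP (actP s P) = actP (lift_perm ord_max ord_max s) (incP P).
Proof.
rewrite /actP /incP imsetU1 imset_set1 lift_perm_id; congr (_ |: _).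
rewrite -!imset_comp; apply: eq_imset => B /=.
by rewrite /liftS -!imset_comp; apply: eq_imset => x /=; rewrite lift_perm_lift.
Qed.

Lemma incC_act C (s : 'S_n) : incC (actC s C) = actC (lift_perm ord_max ord_max s) (incC C).
Proof. by rewrite /actC /incC -!imset_comp; apply: eq_imset => P /=; rewrite incP_act. Qed.

Lemma incC_subset C D : (incC C \subset incC D) = (C \subset D).
Proof.
apply/idP/idP => [|/imsetS]; last exact.
move/subsetP => s; apply/subsetP => P PC.
have /s : incP P \in incC C by apply: imset_f.
by rewrite mem_imset //; apply: incP_inj.
Qed.

Lemma incC_proper C D : (incC C \proper incC D) = (C \proper D).
Proof. by rewrite !properE !incC_subset. Qed.

(* A chain extending [incC C] can be moved off the last point by a transposition
   fixing [incC C], because its support does not exhaust ['I_n.+1]. *)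
Lemma incC_maxchains T i C : all (fun x => x <= i)%N T -> (2 * i <= n)%N ->
  C \in maxchains n T -> incC C \in maxchains n.+1 T.
Proof.
move=> Ti le; rewrite !inE => /andP[cC /forallP mC]; rewrite incC_chain //=.
apply/forallP => D'; apply/implyP => pD; apply/negP => cD.
have [k kN] : exists k, k \notin csupp D'.
  apply/existsP; rewrite -negb_forall; apply/negP => /forallP h.
  have := card_csupp Ti cD; have -> : csupp D' = setT by apply/setP => k; rewrite [LHS]h inE.
  by rewrite cardsT card_ord ltnNge le.
pose t := tperm k ord_max.
have tC : actC t (incC C) = incC C.
  apply: (actC_fix (incC_chain cC)) => x xC; rewrite tpermD //.
    apply: contraNneq kN => ->; move: xC; rewrite !inE => /exists_inP[P PC h].
    by apply/exists_inP; exists P => //; apply: (subsetP (proper_sub pD)).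
  by apply: contraTneq xC => <-; apply: incC_suppN.
have cD2 := actC_chain t cD.
have [|D cD0 eD] := incC_onto cD2.
  by rewrite csupp_act -[X in X \notin _](tpermL k ord_max) mem_imset //; apply: perm_inj.
have /implyP/(_ _)/negP := mC D; apply => //.
rewrite -incC_proper -eD -tC properEneq imsetS ?proper_sub // andbT.
by rewrite (inj_eq (act_inj (chain_act n.+1) _)) proper_neq.
Qed.

Lemma chain_step T i : all (fun x => x <= i)%N T -> (2 * i <= n)%N ->
  stable_step (chain_act n) (chain_act n.+1) (maxchains n T) (maxchains n.+1 T)
    incC (@csupp n.+1) (2 * i).
Proof.
move=> Ti le; split; try exact: maxchains_acts.
- by move=> C D _ _; apply: incC_inj.
- by move=> C; apply: incC_maxchains Ti le.
- by move=> C s _; apply: incC_act.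
- by move=> C _; apply: incC_suppN.
- move=> C'; rewrite inE => /andP[cC /forallP mC] lC.
  have [C c e] := incC_onto cC lC; exists C => //; rewrite inE c.
  apply/forallP => D; apply/implyP; rewrite -incC_proper -e => pD; apply/negP => cD.
  by have /implyP/(_ pD)/negP := mC (incC D); apply; apply: incC_chain.
- by move=> C'; rewrite inE => /andP[cC _]; apply: card_csupp Ti cC.
- by move=> C' s _; apply: csupp_act.
- by move=> C' s; rewrite inE => /andP[cC _]; apply: actC_fix cC.
Qed.

End ChainInc.

(** * Compositions, conjugate partitions and Young diagrams *)

Lemma blk_cons a l x :
  blk (a :: l) x = (if (x < a)%N then 0 else (blk l (x - a)).+1)%N.
Proof.
rewrite /blk /= take0 /= addn0 (iotaDl 1 1) count_map.
case: ltnP => [xa|ax]; rewrite /= ?add0n.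
  apply/eqP; rewrite -leqn0 leqNgt -has_count; apply/hasPn => k _ /=.
  by rewrite -ltnNge; apply: leq_trans xa (leq_addr _ _).
by rewrite add1n; congr S; apply: eq_count => k /=; rewrite leq_subRL.
Qed.

Lemma blk_lt l x : (x < sumn l -> blk l x < size l)%N.
Proof.
elim: l x => //= a l IH x lt; rewrite blk_cons; case: (ltnP x a) => // ax.
by have := IH (x - a)%N; lia.
Qed.

Lemma sum_blk l j : (\sum_(x < sumn l) (blk l x == j))%N = nth 0%N l j.
Proof.
elim: l j => [|a l IH] j /=; first by rewrite big_ord0 nth_nil.
rewrite big_split_ord /=.
rewrite (eq_bigr (fun=> (0 == j : nat)%N)) => [|x _]; last first.
  by rewrite blk_cons /= ltn_ord.
rewrite sum_nat_const card_ord.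
rewrite (eq_bigr (fun x : 'I_(sumn l) => ((blk l x).+1 == j : nat)%N)) => [|x _]; last first.
  by rewrite blk_cons /= ltnNge leq_addr /= addKn.
case: j => [|j] /=; last by rewrite muln0 add0n -IH; apply: eq_bigr.
by rewrite muln1 big1 ?addn0.
Qed.

(* Position of [x] inside its block, counted from [0]. *)
Fixpoint posn (l : seq nat) (x : nat) : nat :=
  if l is a :: r then if (x < a)%N then x else posn r (x - a) else 0%N.

Lemma posn_lt l x : (x < sumn l -> posn l x < nth 0 l (blk l x))%N.
Proof.
elim: l x => //= a l IH x lt; rewrite blk_cons; case: (ltnP x a) => // ax.
by apply: IH; lia.
Qed.

Lemma blk_posn_inj l x y : (x < sumn l)%N -> (y < sumn l)%N ->
  blk l x = blk l y -> posn l x = posn l y -> x = y.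
Proof.
elim: l x y => //= a l IH x y xl yl; rewrite !blk_cons.
case: (ltnP x a) => xa; case: (ltnP y a) => ya // [e] e'.
suff: (x - a = y - a)%N by lia.
by apply: IH => //; lia.
Qed.

Lemma sum_posn l j :
  (\sum_(x < sumn l) (posn l x == j))%N = count (fun a => j < a)%N l.
Proof.
elim: l => [|a l IH] /=; first by rewrite big_ord0.
rewrite big_split_ord /=; congr addn; last first.
  by rewrite -IH; apply: eq_bigr => x _; rewrite ltnNge leq_addr /= addKn.
rewrite (eq_bigr (fun x : 'I_a => (x == j :> nat)%N : nat)) => [|x _]; last by rewrite ltn_ord.
case: ltnP => ja; last by rewrite big1 // => x _; case: eqP => // e; have := ltn_ord x; lia.
rewrite (bigD1 (Ordinal ja)) //= eqxx big1 // => x; rewrite -val_eqE /= => h.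
by rewrite (negbTE h).
Qed.

Lemma sum_ltn a b : (\sum_(x < b) (x < a))%N = minn a b.
Proof.
elim: b => [|b IH]; first by rewrite big_ord0 minn0.
by rewrite big_ord_recr /= IH; lia.
Qed.

Lemma is_partition_sorted n l : is_partition n l -> sorted geq l.
Proof. by case/and3P. Qed.

Lemma is_partition_sumn n l : is_partition n l -> sumn l = n.
Proof. by case/and3P => _ _ /eqP. Qed.

Lemma geq_trans : transitive geq.
Proof. by move=> x y z /= h1 h2; apply: leq_trans h2 h1. Qed.

Lemma sorted_geq_head l x : sorted geq l -> x \in l -> (x <= head 0 l)%N.
Proof.
case: l => //= a l; rewrite path_sortedE; last exact: geq_trans.
by case/andP => /allP h _; rewrite inE => /orP[/eqP->//|/h].
Qed.

Lemma sorted_geq_nth l a : sorted geq l -> (nth 0 l a <= head 0 l)%N.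
Proof.
move=> sl; have [lt|le] := ltnP a (size l); last by rewrite nth_default.
by apply: sorted_geq_head => //; apply: mem_nth.
Qed.

(** Both sides say that the cell in row [a] and column [b] belongs to the Young diagram. *)
Lemma sorted_ltn_count l a b : sorted geq l ->
  (a < count (fun p => b < p) l)%N = (b < nth 0 l a)%N.
Proof.
elim: l a => [|p l IH] a /=; first by rewrite nth_nil.
rewrite path_sortedE; last exact: geq_trans.
case/andP => /allP h sl; case: a => [|a] /=.
  case: (ltnP b p) => //= pb; apply/negbTE; rewrite -leqNgt leqn0 -leqn0 leqNgt -has_count.
  by apply/hasPn => x /h /= xp; rewrite -leqNgt; apply: leq_trans xp pb.
case: (ltnP b p) => pb; first by rewrite add1n ltnS IH.
rewrite -IH // !ltnNge; congr negb; rewrite add0n.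
suff -> : count (fun p => b < p)%N l = 0%N by [].
apply/eqP; rewrite -leqn0 leqNgt -has_count.
by apply/hasPn => x /h /= xp; rewrite -leqNgt; apply: leq_trans xp pb.
Qed.

Lemma size_conj_part l : size (conj_part l) = head 0%N l.
Proof. by rewrite size_map size_iota. Qed.

Lemma sumn_conj_part l : sorted geq l -> sumn (conj_part l) = sumn l.
Proof.
move=> sl; rewrite sumnE big_map -[X in iota 0 X]subn0 -/(index_iota 0 _) big_mkord.
under eq_bigr do rewrite -sum1_count big_mkcond /=.
rewrite exchange_big /= sumnE; apply: eq_big_seq => p pl.
rewrite (eq_bigr (fun i : 'I_(head 0%N l) => (i < p)%N : nat)) => [|i _]; last by case: ltnP.
by rewrite sum_ltn; apply/minn_idPl/sorted_geq_head.
Qed.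

Lemma count_conj_part l a : sorted geq l ->
  count (fun c => a < c)%N (conj_part l) = nth 0%N l a.
Proof.
move=> sl; rewrite count_map -sum1_count -[X in iota 0 X]subn0 -/(index_iota 0 _).
rewrite big_mkord big_mkcond /=.
rewrite (eq_bigr (fun i : 'I_(head 0%N l) => (i < nth 0 l a)%N : nat)) => [|i _]; last first.
  by rewrite sorted_ltn_count //; case: ltnP.
by rewrite sum_ltn; apply/minn_idPl/sorted_geq_nth.
Qed.

Lemma sumn_take l j : sumn (take j l) = (\sum_(a < j) nth 0 l a)%N.
Proof.
elim: l j => [|p l IH] [|j] /=; rewrite ?big_ord0 //.
  by rewrite big1 // => i _; rewrite nth_nil.
by rewrite big_ord_recl /= IH.
Qed.

(** Counts the cells in the first [j] rows column by column. *)
Lemma sum_minn_conj l j : sorted geq l ->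
  (\sum_(b < head 0 l) minn j (nth 0 (conj_part l) b))%N = sumn (take j l).
Proof.
move=> sl; rewrite sumn_take.
rewrite (eq_bigr (fun a : 'I_j => (\sum_(b < head 0 l) (a < nth 0 (conj_part l) b))%N)).
  by rewrite exchange_big /=; apply: eq_bigr => b _; rewrite sum_ltn minnC.
move=> a _; rewrite -(count_conj_part a sl) -sum1_count (big_nth 0%N) size_conj_part.
by rewrite big_mkord big_mkcond /=; apply: eq_bigr => b _; case: ltnP.
Qed.

Lemma mem_allseqs k n l : (size l <= k)%N -> all (fun x => 0 < x <= n)%N l ->
  l \in allseqs k n.
Proof.
elim: k l => [|k IH] [|a l] //= sl /andP[/andP[a0 an] hl].
rewrite inE /=; apply/allpairsP; exists (a, l) => /=; split => //.
  by rewrite mem_iota a0 add1n ltnS.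
exact: IH.
Qed.

Lemma mem_partitions n l : (l \in partitions n) = is_partition n l.
Proof.
rewrite mem_undup mem_filter; case: (boolP (is_partition n l)) => //= pl.
have /and3P[_ /allP h0 /eqP sl] := pl; apply: mem_allseqs.
  rewrite -sl; elim: l h0 {pl sl} => //= a l IH h0.
  have := h0 a (mem_head _ _); have := IH (fun x xl => h0 x (@mem_behead _ (a :: l) x xl)); lia.
apply/allP => x xl; rewrite h0 //= -sl.
elim: l xl {pl sl h0} => //= a l IH; rewrite inE => /orP[/eqP->|/IH]; lia.
Qed.

Lemma uniq_partitions n : uniq (partitions n).
Proof. exact: undup_uniq. Qed.

(** * Words of given content and Young permutation characters *)

Section Words.
Variables n k : nat.
Notation word := {ffun 'I_n -> 'I_k}.
Implicit Types (w : word) (l : seq nat) (s : 'S_n).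

Definition word_act_fun w s : word := [ffun x => w ((s^-1)%g x)].

Lemma word_act1 : word_act_fun^~ 1%g =1 id.
Proof. by move=> w; apply/ffunP => x; rewrite ffunE invg1 perm1. Qed.

Lemma word_actM w : act_morph word_act_fun w.
Proof. by move=> s t; apply/ffunP => x; rewrite !ffunE invMg permM. Qed.

Definition word_act : {action 'S_n &-> word} := TotalAction word_act1 word_actM.

Lemma word_actE w s x : word_act w s x = w ((s^-1)%g x).
Proof. by rewrite /= ffunE. Qed.

Lemma word_act_eqP w s : (word_act w s = w) <-> (forall x, w (s x) = w x).
Proof.
split=> [e x|e]; first by rewrite -{1}e word_actE permK.
by apply/ffunP => x; rewrite word_actE -{2}(permKV s x) e.
Qed.

(** For [sumn l = n] and [size l <= k] this is a model of the cosets of the Young subgroup of [l],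
    the stabilizer of the word [blk l]. *)
Definition words l : {set word} :=
  [set w : word | [forall j : 'I_k, (\sum_(x < n) (w x == j))%N == nth 0%N l j]].

Lemma wordsP l w : (size l <= k)%N ->
  reflect (forall j : nat, (\sum_(x < n) (w x == j :> nat))%N = nth 0%N l j) (w \in words l).
Proof.
move=> sl; rewrite inE; apply: (iffP forallP) => h j; last by apply/eqP/(h j).
have [jk|kj] := ltnP j k; first exact/eqP/(h (Ordinal jk)).
rewrite nth_default ?(leq_trans sl) // big1 // => x _; case: eqP => // e.
by have := ltn_ord (w x); lia.
Qed.

Lemma words_act_mem l w s : (word_act w s \in words l) = (w \in words l).
Proof.
rewrite !inE; apply: eq_forallb => j; congr (_ == _).
rewrite (reindex_inj (@perm_inj _ s)) /=; apply: eq_bigr => x _.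
by rewrite ffunE permK.
Qed.

Lemma words_acts l : [acts Sn n, on words l | word_act].
Proof. by apply/actsP => s _ w; apply: words_act_mem. Qed.

Lemma words_trans l w w' : w \in words l -> w' \in words l ->
  exists s, w' = word_act w s.
Proof.
rewrite !inE => /forallP h /forallP h'.
have : perm_eq [tuple w x | x < n] [tuple w' x | x < n].
  apply/allP => j _ /=; rewrite !count_map -!sum1_count -!enumT !big_enum_cond /= [X in X == _]big_mkcond [X in _ == X]big_mkcond /=.
  have := h j; rewrite -(eqP (h' j)) => /eqP e; apply/eqP.
  by move: e; congr (_ = _); apply: eq_bigr => x _; rewrite -val_eqE; case: (_ == _).
move=> /tuple_permP[p e]; exists p; apply/ffunP => x; rewrite word_actE.
have {}e : [tuple w x | x < n] = [tuple tnth [tuple w' x | x < n] (p i) | i < n] by exact: val_inj.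
by have := congr1 (fun t => tnth t ((p^-1)%g x)) e; rewrite !tnth_mktuple permKV.
Qed.

End Words.

Lemma mem_young n c (s : 'S_n) :
  (s \in young_group n c) = [forall x : 'I_n, blk c (s x) == blk c x].
Proof. by rewrite inE. Qed.

Lemma blk_word n k l : sumn l = n -> (size l <= k)%N ->
  exists2 w : {ffun 'I_n -> 'I_k}, w \in words n k l & forall x, w x = blk l x :> nat.
Proof.
move=> sl sk.
have lt (x : 'I_n) : (blk l x < k)%N by apply: leq_trans (blk_lt _) sk; rewrite sl.
exists [ffun x => Ordinal (lt x)] => [|x]; last by rewrite ffunE.
apply/wordsP => // j; subst n; rewrite -sum_blk; apply: eq_bigr => x _.
by rewrite ffunE.
Qed.

Section YoungWord.
Variables (n k : nat) (l : seq nat).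
Hypotheses (sl : sumn l = n) (sk : (size l <= k)%N).
Notation Y := (young_group n l).
Notation act := (word_act n k).

Lemma young_stab (w0 : {ffun 'I_n -> 'I_k}) s :
  (forall x, w0 x = blk l x :> nat) -> (s \in Y) = (act w0 s == w0).
Proof.
move=> hw0; rewrite mem_young; apply/forallP/eqP => h; last first.
  by move=> x; rewrite -!hw0; move/word_act_eqP: h => ->.
by apply/word_act_eqP => x; apply: val_inj; rewrite /= !hw0; apply/eqP.
Qed.

(** The elements counted form a translate of the stabilizer of [w0], which is the Young subgroup. *)
Lemma card_word_conj (w0 w : {ffun 'I_n -> 'I_k}) :
  w0 \in words n k l -> w \in words n k l -> (forall x, w0 x = blk l x :> nat) ->
  #|[set y | act w0 (y^-1)%g == w]| = #|Y|.
Proof.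
move=> w0W wW hw0; have [s0 ->] := words_trans w0W wW.
have fI : injective (fun y : 'S_n => (s0 * y)%g) by move=> y z /mulgI.
rewrite -[RHS](card_preimset _ fI); congr #|pred_of_set _|; apply/setP => y.
rewrite [LHS]in_set [RHS]in_set -groupV invMg (young_stab _ hw0) actMin ?inE //.
apply/eqP/eqP => [->|e]; first by rewrite actK.
by rewrite -{2}e actKV.
Qed.

Lemma Ind_young1 : 'Ind[Sn n] (1 : 'CF(Y)) = permchar act (words n k l).
Proof.
have [w0 w0W hw0] := blk_word sl sk.
apply/cfun_inP => s _; rewrite cfIndE ?subsetT // permcharE; last exact: words_acts.
apply: (mulfI (neq0CG Y)); rewrite mulVKf ?neq0CG //.
(* The summand at [y] tests whether [s ^ y] stabilizes [w0], that is, whether [s] fixes the word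
   [act w0 y^-1]. Each word arises from as many [y] as [Y] has elements, which cancels the
   normalization. *)
rewrite (partition_big (fun y => act w0 (y^-1)%g) (mem (words n k l))) /= => [|y _]; last first.
  by rewrite words_act_mem.
rewrite -[X in _ = _ * X%:R]sum1_card natr_sum mulr_sumr.
rewrite [RHS](eq_bigl (fun w => (w \in words n k l) && (act w s == w))); last first.
  by move=> w; rewrite in_setI (sameP afix1P eqP).
rewrite big_mkcondr /=; apply: eq_bigr => w wW.
rewrite (eq_bigr (fun=> (act w s == w)%:R)) => [|y /andP[_ /eqP <-]]; last first.
  rewrite cfun1E (young_stab _ hw0) conjgE; congr (_%:R); congr nat_of_bool.
  rewrite !actMin ?inE //; apply/eqP/eqP => [/(canRL (actK act y)) //|->].
  exact: (actKV act y w0).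
rewrite sumr_const -(card_word_conj w0W wW hw0).
have -> : #|[pred y in Sn n | act w0 (y^-1)%g == w]| = #|[set y | act w0 (y^-1)%g == w]|.
  by apply: eq_card => y; rewrite !inE.
by case: (_ == w); rewrite ?mulr1 ?mul0rn.
Qed.

End YoungWord.

(** * Pairings with induced sign characters, and dominance *)

Lemma sgnCFE n (s : 'S_n) : sgnCF n s = (-1) ^+ odd_perm s.
Proof. by rewrite /sgnCF mkCFE // => {}s t; rewrite odd_permJ. Qed.

Lemma sgnCF_char n : sgnCF n \is a character.
Proof.
pose r (s : 'S_n) : 'M[algC]_1 := ((-1) ^+ odd_perm s)%:M.
have rP : mx_repr (Sn n) r.
  split=> [|s t _ _]; first by rewrite /r odd_perm1.
  by rewrite /r odd_permM signr_addb scalar_mxM.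
suff -> : sgnCF n = cfRepr (MxRepresentation rP) by apply: cfRepr_char.
by apply/cfun_inP => s sG; rewrite sgnCFE cfunE sG mulr1n /= mxtrace_scalar.
Qed.

Definition signed_young n c : 'CF(Sn n) := 'Ind[Sn n] ('Res[young_group n c] (sgnCF n)).

Lemma signed_young_char n c : signed_young n c \is a character.
Proof. by rewrite /signed_young cfInd_char ?cfRes_char ?sgnCF_char. Qed.

Section SignedPairing.
Variables (n : nat) (T : finType) (to : {action 'S_n &-> T}) (X : {set T}).
Hypothesis aX : [acts Sn n, on X | to].
Variable c : seq nat.
Notation Y := (young_group n c).

Definition stab_sgn (x : T) : algC := \sum_(y in Y | to x y == x) (-1) ^+ odd_perm y.

Lemma cfdot_signed_young :
  '[permchar to X, signed_young n c] = #|Y|%:R^-1 * \sum_(x in X) stab_sgn x.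
Proof.
rewrite -cfdot_Res_l cfdotE; congr (_ * _).
rewrite (eq_bigr (fun y => \sum_(x in X | to x y == x) (-1) ^+ odd_perm y)).
  rewrite (exchange_big_dep (mem X)) /=; last by move=> y x _ /andP[].
  by apply: eq_bigr => x xX; apply: eq_bigl => y; rewrite xX.
move=> y yY; rewrite !cfResE ?subsetT // permcharE // sgnCFE.
rewrite rmorphXn rmorphN rmorph1 /= sumr_const -[RHS]mulr_natl; congr (_%:R * _).
by apply: eq_card => x; rewrite in_setI (sameP afix1P eqP).
Qed.

(** Multiplication by the transposition is a sign-reversing bijection of the stabilizer of [x] in
    the Young subgroup. *)
Lemma stab_sgn_tperm x (a b : 'I_n) : a != b -> blk c a = blk c b ->
  to x (tperm a b) = x -> stab_sgn x = 0.
Proof.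
move=> ab eb xt.
have tY : tperm a b \in Y.
  by rewrite mem_young; apply/forallP => z; case: tpermP => // ->; rewrite eb.
have e : stab_sgn x = - stab_sgn x.
  rewrite {1}/stab_sgn (reindex_inj (mulIg (tperm a b))) /= -sumrN.
  apply: eq_big => [y|y _]; last by rewrite odd_permM odd_tperm ab addbT signrN.
  rewrite groupMr // actMin ?inE //; congr andb.
  by rewrite -{2}xt (inj_eq (act_inj to _)).
by move/eqP: e; rewrite -addr_eq0 -mulr2n mulrn_eq0 /= => /eqP.
Qed.

Lemma cfdot_signed_young0 :
  (forall x, x \in X -> exists a b : 'I_n, [/\ a != b, blk c a = blk c b & to x (tperm a b) = x]) ->
  '[permchar to X, signed_young n c] = 0.
Proof.
move=> h; rewrite cfdot_signed_young big1 ?mulr0 // => x /h[a [b [ab eb xt]]].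
exact: stab_sgn_tperm xt.
Qed.

End SignedPairing.

(** Injectivity on each block of [c]. When [c] lists column lengths, this is a filling of the
    diagram without repeated entries in a column. *)
Definition good_word n k (c : seq nat) (w : {ffun 'I_n -> 'I_k}) : bool :=
  [forall x, forall y, (blk c (val x) == blk c (val y)) && (w x == w y) ==> (x == y)].

Lemma good_wordP n k c (w : {ffun 'I_n -> 'I_k}) :
  reflect (forall x y : 'I_n, blk c x = blk c y -> w x = w y -> x = y) (good_word c w).
Proof.
apply: (iffP forallP) => [h x y e1 e2|h x].
  by have /forallP/(_ y) := h x; rewrite e1 e2 !eqxx /= => /eqP.
by apply/forallP => y; apply/implyP => /andP[/eqP e1 /eqP e2]; apply/eqP/h.
Qed.

(** A good word has trivial stabilizer in the Young subgroup; any other word is fixed by the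
    transposition of two equal letters in one block. *)
Lemma word_stab_sgn n k c (w : {ffun 'I_n -> 'I_k}) :
  stab_sgn (word_act n k) c w = (good_word c w)%:R.
Proof.
have [/good_wordP gw|] := boolP (good_word c w).
  rewrite /stab_sgn (big_pred1 1%g) ?odd_perm1 // => y.
  apply/andP/eqP => [[yY /eqP/word_act_eqP yw]|->]; last by rewrite group1 act1.
  apply/permP => x; rewrite perm1; apply: gw; last exact: yw.
  by move: yY; rewrite mem_young => /forallP/(_ x)/eqP.
rewrite negb_forall => /existsP[x]; rewrite negb_forall => /existsP[y].
rewrite negb_imply => /andP[/andP[/eqP eb /eqP ew] xy].
apply: (stab_sgn_tperm xy eb); apply/word_act_eqP => z.
by case: tpermP => // ->; rewrite ew.
Qed.

(** Up to the factor 1/|Y| the pairing counts good words, so nothing cancels. *)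
Lemma cfdot_words_signed n k l c :
  reflect (exists2 w, w \in words n k l & good_word c w)
    ('[permchar (word_act n k) (words n k l), signed_young n c] != 0).
Proof.
rewrite cfdot_signed_young; last exact: words_acts.
rewrite mulf_eq0 invr_eq0 (negbTE (neq0CG _)) /=.
rewrite (eq_bigr (fun w => (good_word c w)%:R)) => [|w _]; last exact: word_stab_sgn.
rewrite -natr_sum pnatr_eq0 sum_nat_eq0 negb_forall.
apply: (iffP existsP) => [[w]|[w wW gw]].
  by rewrite negb_imply => /andP[wW]; rewrite eqb0 negbK; exists w.
by exists w; rewrite negb_imply wW gw.
Qed.

(* The positions inside the columns of the Young diagram of [l] form a good word. *)
Lemma good_word_exists n k l : is_partition n l -> (size l <= k)%N ->
  exists2 w, w \in words n k l & good_word (conj_part l) w.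
Proof.
move=> pl sk; have srt := is_partition_sorted pl.
have sc : sumn (conj_part l) = n by rewrite sumn_conj_part // (is_partition_sumn pl).
have lt (x : 'I_n) : (posn (conj_part l) x < k)%N.
  have := @posn_lt (conj_part l) x; rewrite sc => /(_ (ltn_ord x)) h.
  apply: leq_trans sk; apply: leq_trans h _.
  have [hs|hs] := ltnP (blk (conj_part l) x) (size (conj_part l)).
    rewrite (nth_map 0%N); last by rewrite size_conj_part in hs; rewrite size_iota.
    exact: count_size.
  by rewrite nth_default.
exists [ffun x => Ordinal (lt x)].
  apply/wordsP => // j; rewrite -count_conj_part // -sum_posn.
  by rewrite sc; apply: eq_bigr => x _; rewrite ffunE.
apply/good_wordP => x y eb; rewrite !ffunE => -[ep]; apply: val_inj.
by apply: (@blk_posn_inj (conj_part l)); rewrite ?sc ?ltn_ord.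
Qed.

(* Gale-Ryser direction: a word of content [l] injective on the columns of [m]
   forces [l] to be dominated by [m]. *)
Lemma good_word_dominance n k l m (w : {ffun 'I_n -> 'I_k}) j :
  is_partition n m -> (size l <= k)%N -> w \in words n k l -> good_word (conj_part m) w ->
  (sumn (take j l) <= sumn (take j m))%N.
Proof.
move=> pm sk wW /good_wordP gw; have srt := is_partition_sorted pm.
have sc : sumn (conj_part m) = n by rewrite sumn_conj_part // (is_partition_sumn pm).
have hb (x : 'I_n) : (blk (conj_part m) x < head 0 m)%N.
  by rewrite -size_conj_part blk_lt // sc.
(* The entries below [j] in column [b]; together they are the first [j] parts of the content. *)
pose N b := (\sum_(x < n | blk (conj_part m) x == b) (w x < j))%N.
rewrite -(sum_minn_conj j srt).
apply: (@leq_trans (\sum_(b < head 0 m) N b)%N).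
  rewrite sumn_take (eq_bigr (fun a : 'I_j => \sum_(x < n) (w x == a :> nat))%N) => [|a _]; last first.
    by move/wordsP: wW => ->.
  rewrite exchange_big /= /N.
  rewrite (partition_big (fun x => Ordinal (hb x)) xpredT) //=.
  apply: eq_leq; apply: eq_bigr => b _.
  apply: eq_big => [x|x _]; first by rewrite -val_eqE.
  case: (ltnP (w x) j) => wj; last first.
    by rewrite big1 // => a _; case: eqP => // e; have := ltn_ord a; lia.
  rewrite (bigD1 (Ordinal wj)) //= eqxx big1 // => a; rewrite -val_eqE /= eq_sym.
  by move/negbTE => ->.
(* At most [j] such entries because they are distinct within a column, and at most the height of the
   column. *)
apply: leq_sum => b _; rewrite leq_min; apply/andP; split.
  rewrite /N (eq_bigr (fun x : 'I_n => \sum_(a < j) (w x == a :> nat))%N) => [|x _]; last first.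
    case: (ltnP (w x) j) => wj; last first.
      by rewrite big1 // => a _; case: eqP => // e; have := ltn_ord a; lia.
    rewrite (bigD1 (Ordinal wj)) //= eqxx big1 // => a; rewrite -val_eqE /= eq_sym.
    by move/negbTE => ->.
  rewrite exchange_big /= -[leqRHS]card_ord -sum1_card; apply: leq_sum => a _.
  rewrite (eq_bigr (fun x : 'I_n => if w x == a :> nat then 1 else 0)%N) => [|x _]; last by case: eqP.
  rewrite -big_mkcondr sum1_card; apply/card_le1_eqP => x y.
  move=> /andP[/eqP bx /eqP wx] /andP[/eqP by_ /eqP wy].
  by apply: gw; [rewrite bx by_ | apply: val_inj; rewrite /= wx wy].
rewrite -sum_blk sc /N big_mkcond; apply: leq_sum => x _.
by case: eqP => // _; case: (_ < _)%N.
Qed.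

(** * Adding a point to a word *)

Section WordStep.
Variables n m : nat.
Notation lf := (lift (@ord_max n)).

(** The letter [ord0] stands for the padded first row, the only part of the content nu[n] that grows
    with n, so the new point receives it. *)
Definition inc_word (w : {ffun 'I_n -> 'I_m.+1}) : {ffun 'I_n.+1 -> 'I_m.+1} :=
  [ffun x => if unlift ord_max x is Some y then w y else ord0].

Definition word_supp (w : {ffun 'I_n.+1 -> 'I_m.+1}) : {set 'I_n.+1} :=
  [set x | w x != ord0].

Lemma inc_word_lift w x : inc_word w (lf x) = w x.
Proof. by rewrite ffunE liftK. Qed.

Lemma inc_word_max w : inc_word w ord_max = ord0.
Proof. by rewrite ffunE unlift_none. Qed.

Lemma inc_word_words nu w : (sumn nu <= n)%N ->
  (inc_word w \in words n.+1 m.+1 ((n.+1 - sumn nu)%N :: nu))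
    = (w \in words n m.+1 ((n - sumn nu)%N :: nu)).
Proof.
move=> le; rewrite !inE; apply: eq_forallb => j.
rewrite (bigD1_ord ord_max) //= inc_word_max.
under eq_bigr do rewrite inc_word_lift.
by case: j => [[|j] hj] //=; rewrite subSn // add1n eqSS.
Qed.

Lemma word_step nu : (sumn nu <= n)%N ->
  stable_step (word_act n m.+1) (word_act n.+1 m.+1)
    (words n m.+1 ((n - sumn nu)%N :: nu)) (words n.+1 m.+1 ((n.+1 - sumn nu)%N :: nu))
    inc_word word_supp (sumn nu).
Proof.
move=> le; split; try exact: words_acts.
- move=> w w' _ _ /ffunP e; apply/ffunP => x.
  by have := e (lf x); rewrite !inc_word_lift.
- by move=> w wW; rewrite inc_word_words.
- move=> w s _; apply/ffunP => x; rewrite word_actE lift_permV.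
  have [->|/ord_max_liftP[y ->]] := eqVneq x ord_max.
    by rewrite lift_perm_id !inc_word_max.
  by rewrite lift_perm_lift !inc_word_lift ffunE.
- by move=> w _; rewrite inE inc_word_max eqxx.
- move=> w' w'W; rewrite inE negbK => /eqP w0.
  have e : w' = inc_word [ffun x => w' (lf x)].
    apply/ffunP => x; have [->|/ord_max_liftP[y ->]] := eqVneq x ord_max.
      by rewrite inc_word_max.
    by rewrite inc_word_lift ffunE.
  by exists [ffun x => w' (lf x)]; rewrite // -inc_word_words // -e.
- move=> w'; rewrite inE => /forallP/(_ ord0) /= /eqP h.
  suff e : #|~: word_supp w'| = (n.+1 - sumn nu)%N.
    by rewrite -(leq_add2r #|~: word_supp w'|) cardsC card_ord e subnKC ?(leqW le).
  rewrite -h -sum1_card big_mkcond /=; apply: eq_bigr => x _.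
  by rewrite !inE negbK; case: (w' x == ord0).
- move=> w' s _; apply/setP => x; rewrite -(permKV s x) mem_imset; last exact: perm_inj.
  by rewrite !inE ffunE permK.
- move=> w' s _ h; apply/ffunP => x; rewrite word_actE.
  have [/h e|] := boolP ((s^-1)%g x \in word_supp w').
    by rewrite -[in RHS](permKV s x) e.
  rewrite inE negbK => /eqP e0; rewrite e0; apply/eqP; rewrite eq_sym; apply/negPn/negP => nx.
  have /h e : x \in word_supp w' by rewrite inE.
  by case/negP: nx; rewrite -e0 -{2}e permK.
Qed.

End WordStep.

(** * Young characters detect all class functions *)

(** With a common representative r chosen in each orbit, the conjugating permutation sends the k-th
    iterate of r under [s] to its k-th iterate under [t]. *)
Lemma same_porbits_conj (T : finType) (s t : {perm T}) :
  (forall x, porbit s x = porbit t x) -> exists g : {perm T}, t = (s ^ g)%g.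
Proof.
move=> est.
pose r x := odflt x [pick z in porbit s x].
have rin x : r x \in porbit s x.
  by rewrite /r; case: pickP => [z //|/(_ x)]; rewrite porbit_id.
have rE x y : porbit s x = porbit s y -> r x = r y.
  move=> e; rewrite /r e; case: pickP => // /(_ y).
  by rewrite porbit_id.
have por x : porbit s (r x) = porbit s x by apply/eqP; rewrite eq_porbit_mem.
pose N x := #|porbit s (r x)|.
pose idx x := index x (traject s (r x) (N x)).
have xin x : x \in traject s (r x) (N x) by rewrite -porbit_traject por porbit_id.
have idx_lt x : (idx x < N x)%N by rewrite -[X in (_ < X)%N](size_traject s (r x)) index_mem.
have idxK x : iter (idx x) s (r x) = x by rewrite -(nth_traject s (idx_lt x)) nth_index.
have idxU x k : (k < N x)%N -> iter k s (r x) = x -> idx x = k.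
  move=> kN e; rewrite /idx -{1}e -(nth_traject s kN) index_uniq ?size_traject //.
  exact: uniq_traject_porbit.
pose g x := iter (idx x) t (r x).
have gpor x : porbit s (g x) = porbit s x.
  by rewrite /g est -permX -[porbit s x]por est; apply/eqP; rewrite eq_porbit_mem mem_porbit.
have gI : injective g.
  move=> x y e; have exy : porbit s x = porbit s y by rewrite -gpor e gpor.
  have er := rE _ _ exy; have eN : N x = N y by rewrite /N er.
  suff ei : idx x = idx y by rewrite -(idxK x) ei er idxK.
  have ut := uniq_traject_porbit t (r x); rewrite -est -/(N x) in ut.
  apply/eqP; rewrite -(nth_uniq (r x) _ _ ut) ?size_traject ?idx_lt //; last by rewrite eN.
  rewrite !nth_traject ?idx_lt -?eN ?idx_lt ?eN ?idx_lt //.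
  by move: e; rewrite /g -er => ->.
exists (perm gI); rewrite conjgE.
suff e : (s * perm gI = perm gI * t)%g by rewrite e mulKg.
apply/permP => x; rewrite !permM !permE.
have ps : porbit s (s x) = porbit s x by apply/eqP; rewrite eq_porbit_mem -{1}(expg1 s) mem_porbit.
have er := rE _ _ ps; have eN : N (s x) = N x by rewrite /N er.
(* Either [s] advances the index by one, or it wraps around to [r x]; [t] then wraps too, as its
   orbit has the same size. *)
have [lt|ge] := ltnP (idx x).+1 (N x).
  by rewrite /g (idxU (s x) (idx x).+1) ?eN ?er //= idxK.
have eNx : N x = (idx x).+1 by apply/eqP; rewrite eqn_leq ge idx_lt.
have sx : s x = r x by rewrite -[in LHS](idxK x) -iterS -eNx iter_porbit.
rewrite /g (idxU (s x) 0%N) ?eN ?er //=; last by rewrite eNx.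
by rewrite -iterS -eNx /N est iter_porbit.
Qed.

Lemma sorted_filter_gt0_nth (t : seq nat) j : sorted geq t ->
  nth 0%N (filter (fun x => 0 < x)%N t) j = nth 0%N t j.
Proof.
elim: t j => //= a t IH j; rewrite path_sortedE; last exact: geq_trans.
case/andP => /allP h st; case: ltnP => a0; first by case: j => //= j; apply: IH.
have a00 : a = 0%N by lia.
have h0 x : x \in t -> x = 0%N by move=> /h /=; lia.
have -> : [seq x <- t | (0 < x)%N] = [::].
  by apply/eqP; rewrite -[_ == _]negbK -has_filter; apply/hasPn => x /h0 ->.
rewrite nth_nil; case: j => [|j] //=.
have [lt|ge] := ltnP j (size t); last by rewrite nth_default.
by rewrite (h0 _ (mem_nth 0%N lt)).
Qed.

Lemma size_partition n l : is_partition n l -> (size l <= n)%N.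
Proof.
case/and3P => _ /allP h /eqP <-; elim: l h => //= a l IH h.
by have := h a (mem_head _ _); have := IH (fun x xl => h x (@mem_behead _ (a :: l) x xl)); lia.
Qed.

(* Every set partition of ['I_n], given as the fibers of [w], is up to a
   relabelling of the letters a word whose content is a partition of [n]. *)
Lemma word_sorted_content n (w : {ffun 'I_n -> 'I_n}) :
  exists2 l, is_partition n l &
    exists p : 'S_n, [ffun x => p (w x)] \in words n n l.
Proof.
pose c (j : 'I_n) := (\sum_(x < n) (w x == j))%N.
pose t := [tuple c j | j < n].
have : perm_eq (sort geq t) t by rewrite perm_sort.
move=> /tuple_permP[p e].
pose l := filter (fun x => 0 < x)%N (sort geq t).
have srt : sorted geq (sort geq t) by apply: sort_sorted => x y; apply: leq_total.
exists l.
  rewrite /is_partition sorted_filter //; last exact: geq_trans.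
  rewrite filter_all /=; apply/eqP.
  have -> : sumn l = sumn (sort geq t).
    by rewrite /l; elim: (sort geq t) => //= a s IH; case: ltnP => a0 /=; lia.
  rewrite (perm_sumn (permEl (perm_sort _ _))) sumnE big_map big_enum /=.
  rewrite /c exchange_big /= (eq_bigr (fun=> 1%N)) ?sum1_card ?card_ord // => x _.
  by rewrite (bigD1 (w x)) //= eqxx big1 // => j; rewrite eq_sym => /negbTE ->.
exists p^-1%g; rewrite inE; apply/forallP => j; apply/eqP.
rewrite sorted_filter_gt0_nth // e (nth_map j) ?size_enum_ord //.
rewrite nth_ord_enum tnth_mktuple /c; apply: eq_bigr => x _; rewrite ffunE.
by rewrite (can2_eq (permKV p) (permK p)).
Qed.

Section Completeness.
Variable n : nat.
Notation act := (word_act n n).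

(** The pairing is proportional to the sum of all stabilizer sums, and these coincide because [S_n]
    is transitive on words of content [l] and [f] is a class function. *)
Lemma sum_word_stab (f : 'CF(Sn n)) l (w : {ffun 'I_n -> 'I_n}) :
  is_partition n l -> w \in words n n l -> '[f, 'Ind[Sn n] (1 : 'CF(young_group n l))] = 0 ->
  \sum_(s | act w s == w) f s = 0.
Proof.
move=> pl wW; rewrite (Ind_young1 (is_partition_sumn pl) (size_partition pl)) cfdotE.
move/eqP; rewrite mulf_eq0 invr_eq0 (negbTE (neq0CG _)) /= => /eqP f0.
have {f0} : \sum_(v in words n n l) \sum_(s | act v s == v) f s = 0.
  rewrite -[RHS]f0 (exchange_big_dep xpredT) //= [RHS](eq_bigl xpredT) => [|s]; last by rewrite inE.
  apply: eq_bigr => s _; rewrite permchar_conj ?permcharE; try exact: words_acts.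
  rewrite sumr_const mulr_natr; congr (_ *+ _); apply: eq_card => v.
  by rewrite in_setI (sameP afix1P eqP).
rewrite (eq_bigr (fun=> \sum_(s | act w s == w) f s)) => [|v vW].
  rewrite sumr_const => /eqP; rewrite mulrn_eq0 => /orP[|/eqP //].
  by rewrite cards_eq0 => /eqP w0; rewrite w0 inE in wW.
have [g ->] := words_trans wW vW.
rewrite (reindex_inj (conjg_inj g)); apply: eq_big => [s|s _]; last by rewrite cfunJ ?inE.
rewrite conjgE -!actMin ?inE // !mulgA mulgV mul1g actMin ?inE //.
by rewrite (inj_eq (act_inj act g)).
Qed.

(* Induction on the total size of the orbits: the stabilizer of the word of
   orbits of [s] consists of permutations with finer orbits, and those with the
   same orbits are conjugate to [s]. *)
Lemma orthogonal_young (f : 'CF(Sn n)) :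
  (forall l, is_partition n l -> '[f, 'Ind[Sn n] (1 : 'CF(young_group n l))] = 0) -> f = 0.
Proof.
move=> f0; apply/cfun_inP => s _; rewrite cfunE.
pose mu (s : 'S_n) := (\sum_(x < n) #|porbit s x|)%N.
have [N] := ubnP (mu s); elim: N s => // N IH s; rewrite ltnS => muN.
(* Labels every point by a representative of its orbit; only [wE], that the fibers are the orbits of
   [s], is used afterwards. *)
pose w := [ffun x : 'I_n => odflt x [pick z in porbit s x]].
have wE x y : (w x == w y) = (porbit s x == porbit s y).
  rewrite !ffunE; apply/eqP/eqP => [|e]; last first.
    by rewrite e; case: pickP => // /(_ y); rewrite porbit_id.
  case: pickP => [z zx|/(_ x)]; last by rewrite porbit_id.
  case: pickP => [z' zy|/(_ y)]; last by rewrite porbit_id.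
  move=> /= e; rewrite -e in zy.
  by move: zx zy; rewrite -!eq_porbit_mem => /eqP <- /eqP.
clearbody w; have [l pl [p wW]] := word_sorted_content w.
have := sum_word_stab pl wW (f0 l pl).
have stabE t : (act [ffun x => p (w x)] t == [ffun x => p (w x)])
    = [forall x, t x \in porbit s x].
  apply/eqP/forallP => [/word_act_eqP h x|h].
    by have /eqP := h x; rewrite !ffunE (inj_eq perm_inj) wE eq_porbit_mem.
  apply/word_act_eqP => x; apply/eqP.
  by rewrite !ffunE (inj_eq perm_inj) wE eq_porbit_mem.
have porbS (t : 'S_n) : [forall x, t x \in porbit s x] -> forall x, porbit t x \subset porbit s x.
  move=> /forallP h x; apply/subsetP => _ /porbitP[i ->].
  elim: i => [|i IHi]; first by rewrite perm1 porbit_id.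
  rewrite expgSr permM -eq_porbit_mem; rewrite -eq_porbit_mem in IHi; rewrite -(eqP IHi).
  by rewrite eq_porbit_mem.
have leS (t : 'S_n) x : [forall x, t x \in porbit s x] -> (#|porbit t x| <= #|porbit s x|)%N.
  by move=> /porbS h; apply: subset_leq_card.
rewrite (eq_bigl _ _ stabE).
rewrite (bigID (fun t : 'S_n => mu t == mu s)) /= addrC big1 ?add0r => [|t /andP[tS nt]]; last first.
  apply: IH; apply: leq_trans muN; rewrite ltn_neqAle nt /=.
  by apply: leq_sum => x _; apply: leS.
rewrite (eq_bigr (fun=> f s)) => [|t /andP[tS /eqP et]]; last first.
  have eqp x : porbit s x = porbit t x.
    apply/eqP; rewrite eq_sym eqEcard porbS //=.
    have /leqif_sum := fun (x : 'I_n) (_ : true) => leqif_eq (leS t x tS).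
    by rewrite -/(mu t) -/(mu s) => -[_]; rewrite et eqxx => /esym/forallP/(_ x)/eqP ->.
  by have [g ->] := same_porbits_conj eqp; rewrite cfunJ ?inE.
(* All remaining terms equal [f s], and there is at least one of them, namely [t = s]. *)
rewrite sumr_const => /eqP; rewrite mulrn_eq0 => /orP[|/eqP //].
move/eqP/card0_eq/(_ s); rewrite unfold_in /= eqxx andbT => /negbT/negP; case.
by apply/forallP => x; rewrite -{1}(expg1 s) mem_porbit.
Qed.

End Completeness.

(** * The irreducible characters indexed by partitions *)

Definition young_char n l : 'CF(Sn n) := 'Ind[Sn n] (1 : 'CF(young_group n l)).

Lemma young_char_char n l : young_char n l \is a character.
Proof. by rewrite cfInd_char ?cfun1_char. Qed.

Lemma common_constt_neq0 (gT : finGroupType) (G : {group gT}) (phi psi : 'CF(G)) i :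
  phi \is a character -> psi \is a character ->
  '[phi, 'chi_i] != 0 -> '[psi, 'chi_i] != 0 -> '[phi, psi] != 0.
Proof.
move=> cphi cpsi h1 h2; apply/negP => /eqP h.
have /eqP := @constt_ortho_char _ _ _ _ i i cphi cpsi h1 h2 h.
by rewrite cfnorm_irr oner_eq0.
Qed.

(** If no common constituent existed, every term of the pairing expanded over irreducibles would
    vanish, against [good_word_exists]. *)
Lemma chiP_irr n l : is_partition n l ->
  exists i, [/\ chiP n l = 'chi_i, '[young_char n l, 'chi_i] != 0
               & '[signed_young n (conj_part l), 'chi_i] != 0].
Proof.
move=> pl; rewrite /chiP pl.
case: pickP => [i /andP[h1 h2]|h]; first by exists i.
have sz := size_partition pl.
have : '[young_char n l, signed_young n (conj_part l)] != 0.
  rewrite /young_char (Ind_young1 (is_partition_sumn pl) sz).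
  by apply/cfdot_words_signed/good_word_exists.
rewrite cfdot_sum_irr big1 ?eqxx // => i _.
have := h i; rewrite -/(young_char n l) -/(signed_young n _).
case: eqP => [->|_] /=; first by rewrite mul0r.
by move/negbFE/eqP => ->; rewrite conjC0 mulr0.
Qed.

Lemma young_chiP_neq0 n l : is_partition n l -> '[young_char n l, chiP n l] != 0.
Proof. by case/chiP_irr => i [-> h _]. Qed.

(** The character of [m] also occurs in the sign character induced from its column group, so that
    character pairs nontrivially with the Young character of [l], which produces a good word. *)
Lemma young_chiP_dominance n l m j : is_partition n l -> is_partition n m ->
  '[young_char n l, chiP n m] != 0 -> (sumn (take j l) <= sumn (take j m))%N.
Proof.
move=> pl pm; have [i [-> _ hm]] := chiP_irr pm => hl.
have := common_constt_neq0 (young_char_char n l) (signed_young_char _ _) hl hm.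
rewrite /young_char (Ind_young1 (is_partition_sumn pl) (size_partition pl)).
case/cfdot_words_signed => w wW gw.
exact: good_word_dominance pm (size_partition pl) wW gw.
Qed.

Lemma sumn_take_inj (l m : seq nat) : all (fun x => 0 < x)%N l -> all (fun x => 0 < x)%N m ->
  (forall j, sumn (take j l) = sumn (take j m)) -> l = m.
Proof.
elim: l m => [|a l IH] [|b m] //=.
- by move=> _ /andP[b0 _] /(_ 1%N) /=; rewrite take0 /=; lia.
- by move=> /andP[a0 _] _ /(_ 1%N) /=; rewrite take0 /=; lia.
move=> /andP[_ hl] /andP[_ hm] h; have := h 1%N; rewrite /= !take0 /= !addn0 => ab.
by congr cons => //; apply: IH => // j; have := h j.+1; rewrite /= ab => /addnI.
Qed.

Lemma is_partition_all n l : is_partition n l -> all (fun x => 0 < x)%N l.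
Proof. by case/and3P. Qed.

Lemma chiP_inj n l m : is_partition n l -> is_partition n m -> chiP n l = chiP n m -> l = m.
Proof.
move=> pl pm e; apply: (sumn_take_inj (is_partition_all pl) (is_partition_all pm)) => j.
apply/eqP; rewrite eqn_leq; apply/andP; split.
  by apply: (young_chiP_dominance _ pl pm); rewrite -e young_chiP_neq0.
by apply: (young_chiP_dominance _ pm pl); rewrite e young_chiP_neq0.
Qed.

(** A linear relation among the rows of the multiplicity matrix is a class function orthogonal to
    all Young characters, hence zero. *)
Lemma card_Iirr_partitions n : (Nirr (Sn n) <= size (partitions n))%N.
Proof.
pose A : 'M[algC]_(Nirr (Sn n), size (partitions n)) :=
  \matrix_(i, j) '['chi_i, young_char n (nth [::] (partitions n) j)].
suff /eqP <- : row_free A by apply: rank_leq_col.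
apply: inj_row_free => u uA; pose f := \sum_i u 0 i *: 'chi[Sn n]_i.
have f0 : f = 0.
  apply: orthogonal_young => l; rewrite -mem_partitions -index_mem => lP.
  move/matrixP/(_ 0 (Ordinal lP)): uA; rewrite !mxE => <-.
  rewrite cfdot_suml; apply: eq_bigr => i _; rewrite cfdotZl mxE nth_index //.
  by rewrite -index_mem.
apply/rowP => i; rewrite mxE.
have := congr1 (fun g => '[g, 'chi_i]) f0; rewrite cfdot0l => <-.
rewrite cfdot_suml (bigD1 i) //= cfdotZl cfnorm_irr mulr1 big1 ?addr0 // => k ki.
by rewrite cfdotZl cfdot_irr (negbTE ki) mulr0.
Qed.

(** Distinct irreducibles, at least as many as there are in total, must be all of them. *)
Lemma chiP_expansion n (phi : 'CF(Sn n)) :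
  phi = \sum_(l <- partitions n) '[phi, chiP n l] *: chiP n l.
Proof.
pose idx l : Iirr (Sn n) := odflt 0 [pick i | chiP n l == 'chi_i].
have idxE l : l \in partitions n -> chiP n l = 'chi_(idx l).
  rewrite mem_partitions => /chiP_irr[i [e _ _]]; rewrite /idx.
  by case: pickP => [k /eqP //|/(_ i)]; rewrite e eqxx.
have uI : uniq (map idx (partitions n)).
  rewrite map_inj_in_uniq ?uniq_partitions // => l m hl hm e.
  apply: (@chiP_inj n); rewrite -?mem_partitions //.
  by rewrite !idxE // e.
have pI : perm_eq (map idx (partitions n)) (enum (Iirr (Sn n))).
  apply: uniq_perm => //; first exact: enum_uniq.
  have := @uniq_min_size _ (map idx (partitions n)) (enum (Iirr (Sn n))) uI.
  case=> //; first by move=> i _; rewrite mem_enum.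
  rewrite [leqRHS]size_map; apply: leq_trans (card_Iirr_partitions n).
  by apply: eq_leq; rewrite -[RHS]card_ord cardE.
rewrite {1}[phi]cfun_sum_cfdot -big_enum -(perm_big _ pI) big_map /=.
by apply: eq_big_seq => l hl; rewrite idxE.
Qed.

(** * Uniqueness of the Cholesky factor *)

Lemma cholesky_unique (I : finType) (d : I -> nat) (K K' : I -> I -> algC) (b b' : I -> algC) :
  (forall i j, K i j != 0 -> i = j \/ (d i < d j)%N) ->
  (forall i j, K' i j != 0 -> i = j \/ (d i < d j)%N) ->
  (forall i, 0 < K i i) -> (forall i, 0 < K' i i) ->
  (forall i j, \sum_k K i k * K j k = \sum_k K' i k * K' j k) ->
  (forall i, \sum_k K i k * b k = \sum_k K' i k * b' k) ->
  b =1 b'.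
Proof.
move=> tK tK' pK pK' KK Kb.
(* Treats the rows of [K] and the vector [b] uniformly. Induction runs downwards in [d]: entries
   above level [d i] agree, so the off-diagonal terms cancel; taking row [i] itself gives equal
   squares on the diagonal, and positivity gives equal diagonal entries. *)
pose stable c c' := forall i, \sum_k K i k * c k = \sum_k K' i k * c' k.
have sK j : stable (K j) (K' j) by move=> i; apply: KK.
suff main i : forall c c', stable c c' -> c i = c' i by move=> i; apply: main.
pose D := (\max_i d i)%N; have dD k : (d k <= D)%N by apply: leq_bigmax.
have [N] := ubnP (D - d i)%N; elim: N i => // N IH i; rewrite ltnS => leN.
have IHi k : (d i < d k)%N -> forall c c', stable c c' -> c k = c' k.
  by move=> dik; apply: IH; have := dD k; lia.
have offd c c' k : stable c c' -> k != i -> K i k * c k = K' i k * c' k.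
  move=> sc ki; have [dik|dik] := ltnP (d i) (d k).
    by rewrite (IHi _ dik _ _ sc) (IHi _ dik _ _ (sK i)).
  have -> : K i k = 0.
    apply/eqP; apply: contraTT isT => /tK[e|]; first by rewrite e eqxx in ki.
    by rewrite ltnNge dik.
  have -> : K' i k = 0.
    apply/eqP; apply: contraTT isT => /tK'[e|]; first by rewrite e eqxx in ki.
    by rewrite ltnNge dik.
  by rewrite !mul0r.
have diag c c' : stable c c' -> K i i * c i = K' i i * c' i.
  move=> sc; have := sc i; rewrite (bigD1 i) //= [RHS](bigD1 i) //=.
  by rewrite (eq_bigr _ (fun k ki => offd c c' k sc ki)) => /addIr.
have eK : K i i = K' i i.
  have := diag _ _ (sK i); rewrite -!expr2 => /eqP.
  by rewrite eqrXn2 ?ltW // => /eqP.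
by move=> c c' /diag; rewrite eK; apply: mulfI; rewrite gt_eqF.
Qed.

(** * Constituents that do not occur in [alpha] *)

Lemma alpha_char n T : alpha n T \is a character.
Proof. by rewrite alpha_permchar; apply/permchar_char/maxchains_acts. Qed.

(* When the first row is short the columns are few, so two points outside the
   support of a chain share a column and their transposition fixes the chain. *)
Lemma alpha_chiP_eq0 n T i l : all (fun x => x <= i)%N T -> is_partition n l ->
  (2 * i < n - head 0 l)%N -> '[alpha n T, chiP n l] = 0.
Proof.
move=> Ti pl lt; have [k [-> _ hk]] := chiP_irr pl.
apply/eqP; apply: contraTT isT => ha.
have := common_constt_neq0 (alpha_char n T) (signed_young_char _ _) ha hk.
rewrite alpha_permchar cfdot_signed_young0 ?eqxx //; first exact: maxchains_acts.
move=> C; rewrite inE => /andP[cC _]; have srt := is_partition_sorted pl.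
have hb (x : 'I_n) : (blk (conj_part l) x < head 0 l)%N.
  by rewrite -size_conj_part blk_lt // sumn_conj_part // (is_partition_sumn pl).
pose f x := Ordinal (hb x).
have : ~~ dinjectiveb f (mem (~: csupp C)).
  apply/negP => /dinjectiveP fI.
  have := max_card (mem (f @: ~: csupp C)); rewrite card_in_imset // card_ord.
  apply/negP; rewrite -ltnNge -(ltn_add2l #|csupp C|) cardsC card_ord.
  by have := card_csupp Ti cC; move: #|csupp C| => A; lia.
case/dinjectivePn => a aC [b]; rewrite !inE => /andP[ba bC] [e].
exists a, b; split; [by rewrite eq_sym | exact: e |].
apply: (actC_fix cC) => x xC; rewrite tpermD //.
  by apply: contraTneq xC => <-; move: aC; rewrite inE.
by apply: contraTneq xC => <-; move: bC; rewrite !inE.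
Qed.

(** * Stability of the multiplicities *)

Section Stability.

Variable i : nat.
Hypothesis i_gt0 : (0 < i)%N.
Notation m := (2 * i)%N.

Definition small_partitions : seq (seq nat) :=
  undup (flatten [seq partitions k | k <- iota 0 m.+1]).
Notation R := small_partitions.

Lemma mem_small nu : (nu \in R) = (sumn nu <= m)%N && is_partition (sumn nu) nu.
Proof.
rewrite mem_undup; apply/flatten_mapP/andP => [[k]|[le pn]].
  rewrite mem_iota mem_partitions /= add0n ltnS => km pk.
  by rewrite (is_partition_sumn pk) km pk.
by exists (sumn nu); rewrite ?mem_iota ?mem_partitions // add0n ltnS.
Qed.

(* The partition written nu[n] in representation stability. *)
Definition pad n (nu : seq nat) : seq nat := (n - sumn nu)%N :: nu.

Lemma pad_inj n : injective (pad n).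
Proof. by move=> x y []. Qed.

(** Every part of [nu] is at most |nu| <= m <= n - |nu|, which is where n >= 2m = 4i is needed. *)
Lemma pad_partition n nu : (2 * m <= n)%N -> nu \in R -> is_partition n (pad n nu).
Proof.
move=> len; rewrite mem_small => /andP[le /and3P[srt pos _]].
rewrite /is_partition /= pos; apply/and3P; split; last by apply/eqP; lia.
- rewrite path_sortedE ?srt ?andbT; last exact: geq_trans.
  apply/allP => x xnu /=.
  have : (x <= sumn nu)%N by elim: (nu) xnu => //= a s IH; rewrite inE => /orP[/eqP->|/IH]; lia.
  by lia.
- by lia.
Qed.

Lemma perm_pad n : (2 * m <= n)%N ->
  perm_eq [seq l <- partitions n | (n - head 0 l <= m)%N] (map (pad n) R).
Proof.
move=> len; apply: uniq_perm.
- by rewrite filter_uniq ?uniq_partitions.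
- by rewrite map_inj_uniq ?undup_uniq //; apply: pad_inj.
move=> l; rewrite mem_filter mem_partitions; apply/andP/mapP => [[le pl]|[nu nuR ->]].
  (* The empty partition would force n = 0, excluded by [i_gt0]. *)
  case: l pl le => [|a l] pl /= le; first by have := is_partition_sumn pl; rewrite /=; lia.
  have := is_partition_sumn pl => /= sl.
  exists l; last by rewrite /pad; congr cons; lia.
  rewrite mem_small; apply/andP; split; first by lia.
  case/and3P: pl => /= /path_sorted srt /andP[_ pos] _.
  by rewrite /is_partition srt pos /=.
by rewrite pad_partition //=; split => //; move: nuR; rewrite mem_small => /andP[]; lia.
Qed.

Definition thin n (phi : 'CF(Sn n)) :=
  forall l, is_partition n l -> (m < n - head 0 l)%N -> '[phi, chiP n l] = 0.

Lemma sum_thin n n' (phi : 'CF(Sn n)) (F : seq nat -> 'CF(Sn n')) :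
  (2 * m <= n)%N -> thin phi ->
  \sum_(l <- partitions n) '[phi, chiP n l] *: F l =
  \sum_(nu <- R) '[phi, chiP n (pad n nu)] *: F (pad n nu).
Proof.
move=> len th; rewrite (bigID (fun l => n - head 0 l <= m)%N) /= addrC big1_seq ?add0r.
  by rewrite -big_filter (perm_big _ (perm_pad len)) big_map.
move=> l /andP[]; rewrite -ltnNge mem_partitions => lt pl.
by rewrite th // scale0r.
Qed.

Lemma thin_expansion n (phi : 'CF(Sn n)) : (2 * m <= n)%N -> thin phi ->
  phi = \sum_(nu <- R) '[phi, chiP n (pad n nu)] *: chiP n (pad n nu).
Proof. by move=> len th; rewrite {1}[phi]chiP_expansion sum_thin. Qed.

(** Dominance for a single row: a constituent has first row at least n - |nu| >= n - m. *)
Lemma young_thin n nu : (2 * m <= n)%N -> nu \in R -> thin (young_char n (pad n nu)).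
Proof.
move=> len nuR l pl lt; apply/eqP; apply: contraTT isT.
move/(young_chiP_dominance 1%N (pad_partition len nuR) pl) => /=.
rewrite take0 /= addn0; move: nuR; rewrite mem_small => /andP[le _].
by case: l pl lt => [|a l] _ /=; rewrite ?take0 /=; lia.
Qed.

(** One letter for the first row and at most m for the parts of [nu]: an alphabet that does not
    depend on n, as [word_step] requires. *)
Lemma young_pad n nu : (2 * m <= n)%N -> nu \in R ->
  young_char n (pad n nu) = permchar (word_act n m.+1) (words n m.+1 (pad n nu)).
Proof.
move=> len nuR; apply: Ind_young1; first exact/is_partition_sumn/pad_partition.
rewrite /= ltnS; move: nuR; rewrite mem_small => /andP[le pn].
exact: leq_trans (size_partition pn) le.
Qed.

Lemma gram_young_stable n n' mu nu : (2 * m <= n)%N -> (n <= n')%N -> mu \in R -> nu \in R ->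
  '[young_char n' (pad n' mu), young_char n' (pad n' nu)]
    = '[young_char n (pad n mu), young_char n (pad n nu)].
Proof.
move=> len; elim: n' => [|n' IH]; first by rewrite leqn0 => /eqP ->.
rewrite leq_eqVlt => /orP[/eqP-> //|lt] hmu hnu; rewrite -IH // !young_pad //; try lia.
have /andP[lmu _] : (sumn mu <= m)%N && is_partition (sumn mu) mu by rewrite -mem_small.
have /andP[lnu _] : (sumn nu <= m)%N && is_partition (sumn nu) nu by rewrite -mem_small.
apply/esym; apply: (cfdot_permchar_step (word_step _ _) (word_step _ _)); lia.
Qed.

Lemma alpha_young_stable n n' T nu : all (fun x => x <= i)%N T ->
  (2 * m <= n)%N -> (n <= n')%N -> nu \in R ->
  '[alpha n' T, young_char n' (pad n' nu)] = '[alpha n T, young_char n (pad n nu)].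
Proof.
move=> Ti len; elim: n' => [|n' IH]; first by rewrite leqn0 => /eqP ->.
rewrite leq_eqVlt => /orP[/eqP-> //|lt] hnu; rewrite -IH // !young_pad ?alpha_permchar //; try lia.
have /andP[lnu _] : (sumn nu <= m)%N && is_partition (sumn nu) nu by rewrite -mem_small.
apply/esym; apply: (cfdot_permchar_step (chain_step Ti _) (word_step _ _)); lia.
Qed.

(* Shifted partial sums of [nu]; summed over [j] they give a strictly monotone
   statistic for the dominance order on the padded partitions. *)
Definition psum (nu : seq nat) j : nat := (m - sumn nu + sumn (take j nu))%N.
Definition dstat (nu : seq nat) : nat := (\sum_(j < m.+1) psum nu j)%N.

(** Dominance compares [psum] termwise, so if the totals do not increase then all terms agree and
    the partitions coincide. *)
Lemma young_pad_triangular n mu nu : (2 * m <= n)%N -> mu \in R -> nu \in R ->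
  '[young_char n (pad n mu), chiP n (pad n nu)] != 0 -> mu = nu \/ (dstat mu < dstat nu)%N.
Proof.
move=> len hmu hnu h.
have dom j : (psum mu j <= psum nu j)%N.
  have := young_chiP_dominance j.+1 (pad_partition len hmu) (pad_partition len hnu) h.
  by rewrite /psum /=; move: hmu hnu; rewrite !mem_small => /andP[l1 _] /andP[l2 _]; lia.
have [lt|ge] := ltnP (dstat mu) (dstat nu); [by right | left].
have e j : (j < m.+1)%N -> psum mu j = psum nu j.
  move=> jm; apply/eqP; have /leqif_sum := fun (j : 'I_m.+1) (_ : true) => leqif_eq (dom j).
  rewrite -/(dstat mu) -/(dstat nu) => -[le]; rewrite eqn_leq le ge.
  by move=> /esym/forallP/(_ (Ordinal jm)).
move: hmu hnu; rewrite !mem_small => /andP[l1 p1] /andP[l2 p2].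
(* The term [j = 0] recovers the size of the partition. *)
have es : sumn mu = sumn nu by have := e 0%N isT; rewrite /psum !take0 /=; lia.
apply: (sumn_take_inj (is_partition_all p1) (is_partition_all p2)) => j.
have [jm|jm] := ltnP j m.+1; first by have := e j jm; rewrite /psum es => /addnI.
by rewrite !take_oversize // ?(leq_trans (size_partition p1)) ?(leq_trans (size_partition p2)) //; lia.
Qed.

Lemma alpha_coef_stable n n' T nu : all (fun x => x <= i)%N T ->
  (2 * m <= n)%N -> (n <= n')%N -> nu \in R ->
  '[alpha n T, chiP n (pad n nu)] = '[alpha n' T, chiP n' (pad n' nu)].
Proof.
move=> Ti len len' hnu; have len2 : (2 * m <= n')%N by apply: leq_trans len'.
(* Positions in [R] give [cholesky_unique] one finite index type for both n and n'. *)
pose r (k : 'I_(size R)) := nth [::] R k.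
have rR k : r k \in R by apply: mem_nth.
have rI : injective r.
  by move=> x y /eqP; rewrite nth_uniq ?undup_uniq // => /eqP/val_inj.
have sumR (V : nmodType) (F : seq nat -> V) : \sum_(nu <- R) F nu = \sum_k F (r k).
  by rewrite (big_nth [::]) big_mkord.
pose K q j k := '[young_char q (pad q (r j)), chiP q (pad q (r k))].
pose b q k := '[alpha q T, chiP q (pad q (r k))].
have chi_char q k : (2 * m <= q)%N -> chiP q (pad q (r k)) \is a character.
  by move=> lq; have [j [-> _ _]] := chiP_irr (pad_partition lq (rR k)); apply: irr_char.
(* The inner product conjugates scalars on its right; multiplicities are natural numbers, so the
   conjugations disappear in [pair]. *)
have Kconj q j k : (2 * m <= q)%N -> (K q j k)^* = K q j k.
  by move=> lq; apply/conj_natr/Cnat_cfdot_char; rewrite ?young_char_char ?chi_char.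
have bconj q k : (2 * m <= q)%N -> (b q k)^* = b q k.
  by move=> lq; apply/conj_natr/Cnat_cfdot_char; rewrite ?alpha_char ?chi_char.
have tri q : (2 * m <= q)%N -> forall j k, K q j k != 0 -> j = k \/ (dstat (r j) < dstat (r k))%N.
  by move=> lq j k /(young_pad_triangular lq (rR j) (rR k)) [/rI|]; [left|right].
have pos q : (2 * m <= q)%N -> forall k, 0 < K q k k.
  move=> lq k; rewrite lt_def young_chiP_neq0 ?pad_partition //=.
  by apply/natr_ge0/Cnat_cfdot_char; rewrite ?young_char_char ?chi_char.
have pair q (phi : 'CF(Sn q)) j : (2 * m <= q)%N ->
    (forall k, ('[phi, chiP q (pad q (r k))])^* = '[phi, chiP q (pad q (r k))]) ->
    '[phi, young_char q (pad q (r j))] = \sum_k K q j k * '[phi, chiP q (pad q (r k))].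
  move=> lq cphi; rewrite {1}(thin_expansion lq (young_thin lq (rR j))) sumR.
  by rewrite cfdot_sumr; apply: eq_bigr => k _; rewrite cfdotZr -/(K q j k) Kconj.
have := @cholesky_unique _ (fun k => dstat (r k)) (K n) (K n') (b n) (b n')
  (tri n len) (tri n' len2) (pos n len) (pos n' len2).
have iR : (index nu R < size R)%N by rewrite index_mem.
have -> : nu = r (Ordinal iR) by rewrite /r /= nth_index.
apply=> [j k|j].
  rewrite -!pair -?(gram_young_stable len len' (rR k) (rR j)) //.
  - by move=> l; apply: Kconj.
  - by move=> l; apply: Kconj.
rewrite -!pair ?(alpha_young_stable Ti len len' (rR j)) //.
- by move=> l; apply: bconj.
- by move=> l; apply: bconj.
Qed.

Lemma alpha_stable T : all (fun x => x <= i)%N T ->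
  stabilizes_beyond (fun n => alpha n T) (4 * i).
Proof.
move=> Ti n len; rewrite (_ : 4 * i = 2 * m)%N in len *; last by lia.
have th q : thin (alpha q T) by move=> l pl lt; apply: alpha_chiP_eq0 Ti pl lt.
rewrite /shiftCF (sum_thin _ (leqnn _) (th _)) {1}(thin_expansion len (th n)).
apply: eq_big_seq => nu hnu.
rewrite -(alpha_coef_stable Ti (leqnn _) len hnu); congr (_ *: chiP n _).
(* Shifting the first row matches the padding: (n - 4i) + (4i - |nu|) = n - |nu|. *)
rewrite /pad /=; congr cons.
by move: hnu; rewrite mem_small => /andP[le _]; lia.
Qed.

End Stability.

Lemma shiftCF_sum n0 n (I : Type) (s : seq I) (a : I -> algC) (f : I -> 'CF(Sn n0)) :
  shiftCF n0 n (\sum_(j <- s) a j *: f j) = \sum_(j <- s) a j *: shiftCF n0 n (f j).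
Proof.
rewrite /shiftCF; under [RHS]eq_bigr do rewrite scaler_sumr.
rewrite exchange_big /=; apply: eq_bigr => l _.
rewrite cfdot_suml scaler_suml; apply: eq_bigr => j _.
by rewrite cfdotZl scalerA.
Qed.

Theorem mainTheorem18 (S : seq nat) :
  S != [::] -> uniq S -> all (fun x => 0 < x)%N S ->
  let i := (\max_(x <- S) x)%N in
  stabilizes_beyond (fun n => alpha n S) (4 * i)
  /\ stabilizes_beyond (fun n => beta n S) (4 * i).
Proof.
move=> S0 _ Spos i.
have leS : all (fun x => x <= i)%N S by apply/allP => x xS; apply: leq_bigmax_seq.
have i_gt0 : (0 < i)%N.
  case: (S) S0 Spos leS => // a s _ /= /andP[a0 _] /andP[ai _].
  exact: leq_trans a0 ai.
split; first exact: alpha_stable.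
move=> n len; rewrite /beta shiftCF_sum; apply: eq_bigr => w _.
(* A subset of S may have a smaller maximum or be empty; [alpha_stable] only asks for the upper
   bound i, so all terms share the threshold 4i. *)
congr (_ *: _); apply: alpha_stable => //.
by apply/allP => x /mem_mask/(allP leS).
Qed.
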